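(* Let $\kappa$ be an uncountable cardinal, let $K$ be one of the spaces $B(\kappa)$, $P(A(\kappa))$ or $P([0,\omega_1])$, and let $n,m\geq 1$ be natural numbers. Suppose that $L_1,\ldots,L_m$ are compact spaces of uncountable weight such that $K^n$ is homeomorphic to $\prod_{i=1}^m L_i$. Then $m\leq n$.
   Context: $B(\kappa)=\{x\in\ell_2(\kappa):\|x\|_2\leq1\}$ is the unit ball of the Hilbert space $\ell_2(\kappa)$ with the weak topology. $A(\kappa)=\kappa\cup\{\infty\}$ is the one-point compactification of the discrete set $\kappa$. $[0,\omega_1]$ carries the order topology. $P(X)$ is the space of Radon probability measures on the compact space $X$ with the weak$^*$ topology. *)

(* Defs.v *)
From HB Require Import structures.
From mathcomp Require Import all_boot all_order all_algebra.
From mathcomp Require Import all_classical all_reals all_analysis.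
From mathcomp Require Import wochoice ring.

Set Implicit Arguments.
Unset Strict Implicit.
Unset Printing Implicit Defensive.

Import Order.TTheory GRing.Theory Num.Theory.
Import numFieldNormedType.Exports.

Local Open Scope classical_set_scope.
Local Open Scope ring_scope.

Definition homeomorphic (X Y : topologicalType) : Prop :=
  exists (f : X -> Y) (g : Y -> X),
    [/\ cancel f g, cancel g f, continuous f & continuous g].

Definition power (X : topologicalType) (n : nat) : topologicalType :=
  prod_topology (fun _ : 'I_n => X).

Definition compact_space (X : topologicalType) : Prop :=
  compact [set: X] /\ hausdorff_space X.

(* The weight is the least cardinality of a base, so it is uncountable iff
   there is no countable base. *)
Definition uncountable_weight (X : topologicalType) : Prop :=
  ~ @second_countable X.

(* The coarsest topology on S making all the maps phi i continuous. *)
Section family_topology.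
Variables (R : realType) (J : Type) (S : choiceType) (phi : J -> S -> R).

Definition family_topology : topologicalType :=
  sup_topology (fun j => Topological.class (initial_topology (phi j))).

End family_topology.

Section ell2.
Variables (R : realType) (I : choiceType).
Implicit Types x y : I -> R.

Definition sqsum x : \bar R := (\esum_(i in [set: I]) (x i ^+ 2)%:E)%E.

Definition square_summable : {pred I -> R} :=
  mem [set x | (sqsum x < +oo)%E].

Lemma sqsum_ge0 x : (0 <= sqsum x)%E.
Proof. by apply: esum_ge0 => i _; rewrite lee_fin sqr_ge0. Qed.

Lemma sqsumZ_le (a : R) x :
  (sqsum (a *: x)%R <= (a ^+ 2)%:E * sqsum x)%E.
Proof.
apply: ge_ereal_sup => _ [F [finF _] <-].
under eq_fsbigr do rewrite exprMn EFinM.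
rewrite -ge0_mule_fsumr; last by move=> i; rewrite lee_fin sqr_ge0.
by apply: lee_wpmul2l; [rewrite lee_fin sqr_ge0|apply: ereal_sup_ubound; exists F].
Qed.

Lemma sqsumD_le (a b : R) x y : 0 < a -> 0 < b ->
  (sqsum (x + y)%R <= ((a + b) / a)%:E * sqsum x + ((a + b) / b)%:E * sqsum y)%E.
Proof.
move=> a0 b0; apply: ge_ereal_sup => _ [F [finF _] <-].
have xF z : (\sum_(i \in F) (z i ^+ 2)%:E <= sqsum z)%E.
  by apply: ereal_sup_ubound; exists F.
have c0 : 0 <= (a + b) / a by rewrite divr_ge0 ?addr_ge0 ?ltW.
have d0 : 0 <= (a + b) / b by rewrite divr_ge0 ?addr_ge0 ?ltW.
apply: (@le_trans _ _ (((a + b) / a)%:E * (\sum_(i \in F) (x i ^+ 2)%:E)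
    + ((a + b) / b)%:E * (\sum_(i \in F) (y i ^+ 2)%:E))%E); last first.
  by apply: leeD; apply: lee_wpmul2l; rewrite ?lee_fin.
rewrite !ge0_mule_fsumr; [|by move=> i; rewrite lee_fin sqr_ge0..].
rewrite -fsbig_split//=; apply: lee_fsum => // i _.
rewrite -!EFinM -EFinD lee_fin -subr_ge0.
have -> : (a + b) / a * x i ^+ 2 + (a + b) / b * y i ^+ 2 - (x + y) i ^+ 2
    = (b * x i - a * y i) ^+ 2 / (a * b).
  rewrite -[(x + y) i]/(x i + y i).
  have an0 : a != 0 by rewrite gt_eqF.
  have bn0 : b != 0 by rewrite gt_eqF.
  by field; rewrite an0 bn0.
by rewrite divr_ge0 ?sqr_ge0 ?mulr_ge0 ?ltW.
Qed.

Lemma square_summable_submod : submod_closed square_summable.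
Proof.
split.
  rewrite inE /= /sqsum esum1 ?ltry// => i _.
  by rewrite -[(0 : I -> R) i]/(0 : R) expr0n.
move=> a x y; rewrite !inE/= => xf yf.
have h := @sqsumD_le 1 1 (a *: x) y ltr01 ltr01.
apply: (le_lt_trans h); apply: lte_add_pinfty.
- apply: lte_mul_pinfty; rewrite ?lee_fin ?divr_ge0//.
  apply: (le_lt_trans (sqsumZ_le _ _)).
  by apply: lte_mul_pinfty; rewrite ?lee_fin ?sqr_ge0.
- by apply: lte_mul_pinfty; rewrite ?lee_fin ?divr_ge0.
Qed.

HB.instance Definition _ :=
  GRing.isSubmodClosed.Build _ _ square_summable square_summable_submod.

Record ell2 := Ell2 { ell2_fun :> I -> R; ell2P : ell2_fun \in square_summable }.

HB.instance Definition _ := [isSub for ell2_fun].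
HB.instance Definition _ := [Choice of ell2 by <:].
HB.instance Definition _ := [SubChoice_isSubLmodule of ell2 by <:].

Definition ell2_norm (x : ell2) : R := Num.sqrt (fine (sqsum x)).

Lemma sqsum_fin (x : ell2) : sqsum x = (ell2_norm x ^+ 2)%:E.
Proof.
have := ell2P x; rewrite inE /= => xf.
rewrite sqr_sqrtr ?fine_ge0 ?sqsum_ge0// fineK//.
by rewrite ge0_fin_numE ?sqsum_ge0.
Qed.

Lemma ell2_norm_ge0 (x : ell2) : 0 <= ell2_norm x.
Proof. exact: sqrtr_ge0. Qed.

Lemma ell2_norm0_eq0 (x : ell2) : ell2_norm x = 0 -> x = 0.
Proof.
move=> x0; apply/val_inj/funext => i /=.
have : ((x i ^+ 2)%:E <= sqsum x)%E.
  apply: ereal_sup_ubound; exists [set i]; last by rewrite fsbig_set1.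
  by split.
rewrite sqsum_fin x0 expr0n lee_fin => xi.
by apply/eqP; rewrite -sqrf_eq0 eq_le xi sqr_ge0.
Qed.

Lemma ell2_normD (x y : ell2) : ell2_norm (x + y) <= ell2_norm x + ell2_norm y.
Proof.
have [/eqP/ell2_norm0_eq0->|x0] := boolP (ell2_norm x == 0).
  by rewrite add0r lerDr ell2_norm_ge0.
have [/eqP/ell2_norm0_eq0->|y0] := boolP (ell2_norm y == 0).
  by rewrite addr0 lerDl ell2_norm_ge0.
have {}x0 : 0 < ell2_norm x by rewrite lt_neqAle eq_sym x0 ell2_norm_ge0.
have {}y0 : 0 < ell2_norm y by rewrite lt_neqAle eq_sym y0 ell2_norm_ge0.
have := sqsumD_le x y x0 y0.
rewrite -[((x : I -> R) + _)%R]/((x + y)%R : I -> R) !sqsum_fin.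
rewrite -!EFinM -EFinD lee_fin.
rewrite [X in _ <= X -> _](_ : _ = (ell2_norm x + ell2_norm y) ^+ 2); last first.
  by field; rewrite !gt_eqF.
by rewrite ler_pXn2r// nnegrE ?addr_ge0 ?ell2_norm_ge0.
Qed.

Lemma ell2_normZ_le (a : R) (x : ell2) : ell2_norm (a *: x) <= `|a| * ell2_norm x.
Proof.
have := sqsumZ_le a x.
rewrite -[a *: (x : I -> R)]/((a *: x)%R : I -> R) !sqsum_fin.
rewrite -EFinM lee_fin -[a ^+ 2]real_normK ?num_real// -exprMn.
by rewrite ler_pXn2r// nnegrE ?mulr_ge0 ?ell2_norm_ge0.
Qed.

Lemma ell2_normZ (a : R) (x : ell2) : ell2_norm (a *: x) = `|a| * ell2_norm x.
Proof.
have [->|a0] := eqVneq a 0.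
  rewrite normr0 mul0r; apply/eqP; rewrite eq_le ell2_norm_ge0 andbT.
  by have := ell2_normZ_le 0 x; rewrite normr0 mul0r.
apply/eqP; rewrite eq_le ell2_normZ_le/=.
have := ell2_normZ_le a^-1 (a *: x).
rewrite scalerA mulVf// scale1r normfV.
by rewrite ler_pdivlMl// normr_gt0.
Qed.

HB.instance Definition _ := Lmodule_isNormed.Build R ell2
  ell2_normD ell2_normZ ell2_norm0_eq0.

End ell2.

Definition weak_topology (R : realType) (V : normedModType R) :
    topologicalType :=
  family_topology
    (fun f : {f : {linear V -> R^o} | continuous f} => sval f : V -> R).

Definition weak_unit_ball (R : realType) (I : choiceType) : topologicalType :=
  set_type ([set x : ell2 R I | `|x| <= 1] : set (weak_topology (ell2 R I))).

Section radon_probability.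
Variables (R : realType) (X : ptopologicalType).

Definition borel := g_sigma_algebraType (@open X).

(* A [probability] is a function on all subsets of X, whose values outside the
   sigma-algebra are unconstrained. Fixing them to 0 makes equality of Radon
   probabilities coincide with equality on Borel sets; without this P(X) would
   not even be a T0 space. *)
Definition radon (mu : probability borel R) : Prop :=
  (forall A : set borel, measurable A ->
     mu A = ereal_sup [set mu K | K in
              [set K : set X | compact K /\ K `<=` A]]) /\
  (forall A : set borel, ~ measurable A -> mu A = 0%E).

Definition radon_probability : choiceType := set_type [set mu | radon mu].

(* The topology of P(X) is the weak* one *)
Definition prob_space : topologicalType :=
  family_topology
    (fun (f : {f : X -> R | continuous f}) (mu : radon_probability) =>
       \int[set_val mu]_x (sval f x : R)).

End radon_probability.

Definition one_point_discrete (I : choiceType) : ptopologicalType :=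
  one_point_compactification (discrete_topology I).

(* Fix a well-order R of the uncountable set of subsets of nat. The points x
   with countable initial segment {y | R y x} form the least uncountable
   ordinal, and [0, omega1] is obtained by adding a top element None. The
   lemmas omega1_wf, omega1_lt_countable and omega1_uncountable below
   characterize the result up to order isomorphism. *)
Section omega1.

Definition wo_rel : rel (set nat) :=
  sval (well_ordering_principle (set nat : eqType)).

Lemma wo_relP : well_order wo_rel.
Proof. exact: (svalP (well_ordering_principle _)). Qed.

Lemma wo_rel_min (A : set (set nat)) : A !=set0 ->
  exists2 z, A z & forall x, A x -> wo_rel z x.
Proof.
move=> [a Aa].
have [|z [[Az zA] _]] := @wo_relP (mem A); first by exists a; exact: mem_set.
by exists z => [|x Ax]; [exact: set_mem|exact/zA/mem_set].
Qed.

Let wo_chainT : wo_chain wo_rel (mem [set: set nat]).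
Proof. by move=> A _; exact: wo_relP. Qed.

Lemma wo_rel_refl : reflexive wo_rel.
Proof. by move=> x; apply: (wo_chain_reflexive wo_chainT); exact: in_setT. Qed.

Lemma wo_rel_anti : antisymmetric wo_rel.
Proof.
by move=> x y; apply: (wo_chain_antisymmetric wo_chainT); exact: in_setT.
Qed.

Lemma wo_rel_total : total wo_rel.
Proof. by move=> x y; apply: (wo_chainW wo_chainT); exact: in_setT. Qed.

Lemma wo_rel_trans : transitive wo_rel.
Proof.
move=> y x z xy yz.
have [|w xyzw wm] := @wo_rel_min [set x; y; z]; first by exists x; left; left.
have [wx wy wz] : [/\ wo_rel w x, wo_rel w y & wo_rel w z].
  by split; apply: wm; [left; left|left; right|right].
case: xyzw => [[/= wE|/= wE]|/= wE]; first by rewrite -wE.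
- by move: wx; rewrite wE => yx; rewrite (wo_rel_anti (introT andP (conj xy yx))).
- move: wy; rewrite wE => zy.
  by rewrite (wo_rel_anti (introT andP (conj zy yz))).
Qed.

Definition omega1 : Type :=
  set_type [set x : set nat | countable [set y | wo_rel y x]].

HB.instance Definition _ := Choice.on omega1.

Definition omega1_closed : Type := option omega1.

HB.instance Definition _ := Choice.on omega1_closed.

Definition omega1_le (a b : omega1_closed) : bool :=
  match a, b with
  | _, None => true
  | None, Some _ => false
  | Some x, Some y => wo_rel (set_val x) (set_val y)
  end.

Lemma omega1_le_refl : reflexive omega1_le.
Proof. by case=> //= x; exact: wo_rel_refl. Qed.

Lemma omega1_le_anti : antisymmetric omega1_le.
Proof.
by move=> [x|] [y|]//= /wo_rel_anti xy; congr Some; exact: val_inj.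
Qed.

Lemma omega1_le_trans : transitive omega1_le.
Proof. by move=> [x|] [y|] [z|]//=; exact: wo_rel_trans. Qed.

Lemma omega1_le_total : total omega1_le.
Proof. by move=> [x|] [y|]//=; exact: wo_rel_total. Qed.

Fact omega1_display : Order.disp_t. Proof. exact: Order.Disp tt tt. Qed.

HB.instance Definition _ := Order.Le_isPOrder.Build omega1_display omega1_closed
  omega1_le_refl omega1_le_anti omega1_le_trans.
HB.instance Definition _ :=
  Order.POrder_isTotal.Build omega1_display omega1_closed omega1_le_total.

Lemma omega1_le_top (x : omega1_closed) : (x <= None :> omega1_closed)%O.
Proof. by case: x. Qed.

Lemma omega1_wf (A : set omega1_closed) : A !=set0 ->
  exists2 z, A z & forall x, A x -> (z <= x)%O.
Proof.
move=> [a Aa].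
have [[b Ab]|nA] := pselect (exists b : omega1, A (Some b)).
  have [|_ [c Ac <-] cm] := @wo_rel_min (set_val @` [set c | A (Some c)]).
    by exists (set_val b), b.
  by exists (Some c) => // -[x|//] Ax; apply: cm; exists x.
by exists a => // -[x|] Ax; [case: nA; exists x|exact: omega1_le_top].
Qed.

Lemma omega1_lt_countable (x : omega1_closed) : (x < None :> omega1_closed)%O ->
  countable [set y : omega1_closed | (y < x)%O].
Proof.
case: x => [x _|]; last by rewrite ltxx.
have /set_mem /= cx := valP x.
have /countable_injP[f finj] := cx; apply/countable_injP.
exists (fun y : omega1_closed => if y is Some y' then f (set_val y') else 0%N).
have ltP (y : omega1_closed) : (y < Some x)%O ->
    exists2 y', y = Some y' & wo_rel (set_val y') (set_val x).
  case: y => [y /ltW yx|yx]; first by exists y.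
  by move: (le_lt_trans (omega1_le_top (Some x)) yx); rewrite ltxx.
move=> y z; rewrite !inE/= => /ltP[y' -> yx] /ltP[z' -> zx] fyz.
by congr Some; apply: val_inj; apply: finj fyz; rewrite inE.
Qed.

Lemma set_nat_uncountable : ~ countable [set: set nat].
Proof.
move=> /countable_injP[f finj].
pose D := [set n | exists A : set nat, f A = n /\ ~ A n].
have finj' A B : f A = f B -> A = B by apply: finj; rewrite inE.
have [DD|nDD] := pselect (D (f D)).
  by case: (DD) => A [/finj' AD]; rewrite AD.
by apply: (nDD); exists D.
Qed.

Lemma omega1_uncountable :
  ~ countable [set y : omega1_closed | (y < None :> omega1_closed)%O].
Proof.
move=> cO.
have cS : countable [set x : set nat | countable [set y | wo_rel y x]].
  move: cO => /countable_injP[f finj]; apply/countable_injP.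
  pose g (x : set nat) : omega1_closed := (insub x : option omega1).
  have gE z : countable [set t | wo_rel t z] ->
      exists2 z' : omega1, g z = Some z' & set_val z' = z.
    by move=> cz; rewrite /g; case: insubP => [u _ uE|/negP[]];
      [exists u|exact: mem_set].
  have gI z : countable [set t | wo_rel t z] ->
      g z \in [set y : omega1_closed | (y < None)%O].
    by move=> /gE[z' -> _]; rewrite inE/= lt_def omega1_le_top andbT.
  exists (f \o g) => x y /[!inE] cx cy /= fxy.
  have := finj _ _ (gI x cx) (gI y cy) fxy.
  by have [x' -> <-] := gE x cx; have [y' -> <-] := gE y cy => -[->].
apply: set_nat_uncountable.
have [[a na]|all] := pselect (~` [set x | countable [set y | wo_rel y x]] !=set0);
  last first.
  apply: sub_countable cS; apply: subset_card_le => x _.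
  by apply: contrapT => cx; apply: all; exists x.
have [|z nz zm] := @wo_rel_min (~` [set x | countable [set y | wo_rel y x]]).
  by exists a.
case: nz => /=.
have : countable ([set x | countable [set y | wo_rel y x]] `|` [set z]).
  rewrite -bigcup2E; apply: bigcup_countable => // -[//|[|n]] _ /=.
  - exact: countable1.
  - by rewrite /bigcup2/=; exact: finite_set_countable.
apply: sub_countable; apply: subset_card_le => y /= yz.
have [cy|ny] := pselect (countable [set t | wo_rel t y]); first by left.
right; apply: wo_rel_anti; rewrite yz/=; exact: zm.
Qed.

End omega1.

HB.instance Definition _ := Pointed.copy (order_topology omega1_closed) (option omega1).

Definition omega1_space : ptopologicalType := order_topology omega1_closed.

(* Main.v *)
From HB Require Import structures.
Require Import Defs.
From mathcomp Require Import all_boot all_order all_algebra finmap.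
From mathcomp Require Import all_classical all_reals all_analysis.

Set Implicit Arguments.
Unset Strict Implicit.
Unset Printing Implicit Defensive.

Import Order.TTheory GRing.Theory Num.Theory.
Import numFieldNormedType.Exports.

Local Open Scope classical_set_scope.
Local Open Scope ring_scope.

(** Let [K] be one of the three spaces. Each has a separating family of
continuous real functions [phi j], indexed by an uncountable set, and every
set [A] of indices gives the quotient of [K] that remembers only the values
[phi j x] for [j] in [A]. On a fiber of such a quotient put [s <= t] when the
image in the quotient of every neighborhood of [s] contains the image of a
neighborhood of [t] ([fiber_le]). This preorder is determined by the topology
and the equivalence relation, and on a finite product of spaces and relations
it is computed coordinatewise ([fiber_le_prod]).

The geometric input is that, for cofinally many countable [A], each fiber of
[K] is totally preordered and has a least element that is alone in its class
([linear_fibers]). For the Hilbert ball the position of a point in its fiber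
is the norm of the part outside [A]: the larger it is, the less room is left
for the coordinates in [A], so the smaller the image of a neighborhood; the
least point is the one vanishing outside [A]. Probabilities on the one-point
compactification of a discrete set are the families of nonnegative weights of
sum at most 1, and taking square roots of the weights makes them the
nonnegative part of a Hilbert ball, to which the same argument applies
([ball_linear_quotients]). Probabilities on the ordinals up to omega1 are the
nondecreasing functions on that order with values in the unit interval and
value 1 at the top, through their distribution functions; when [A] is the
segment below a countable limit ordinal [al], the position is given by the
value at [al], larger values being lower, and the least point is the function
that jumps to 1 at [al] ([monotone_linear_quotients]).

Suppose now that [K^n] is homeomorphic to a product of [m] factors [L i]. All
these spaces are compact, and a closing-off argument produces one countable
[A] in the cofinal class whose quotient of [K^n] is at the same time a product
of quotients of the factors ([closing_off]). Since [L i] has no countable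
base, the quotient of [L i] identifies two different points
([second_countable_separating]). Hence over a suitable point every factor
contributes a strict chain of two elements, and the power set of ['I_m] embeds
in a product of [n] total preorders; comparing each atom with its complement
gives an injection of ['I_m] into ['I_n] ([product_factors_le]). *)

(** * The order induced on the fibers of a quotient *)

(** [E] is the kernel of a quotient map [q]. Saying that the image under [q]
of a neighborhood of [s] contains the image of a neighborhood of [t] amounts
to saying that the saturation of the former is a neighborhood of [t], so the
quotient space itself never has to be formed. *)
Definition fiber_le (X : topologicalType) (E : X -> X -> Prop) (s t : X) :=
  forall U, nbhs s U -> nbhs t [set y | exists2 x, U x & E x y].

Definition prod_rel (I : Type) (X : I -> Type) (E : forall i, X i -> X i -> Prop)
    (x y : forall i, X i) := forall i, E i (x i) (y i).

Lemma fiber_le_refl (X : topologicalType) (E : X -> X -> Prop) (s : X) :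
  (forall x, E x x) -> fiber_le E s s.
Proof. by move=> Er U sU; apply: filterS sU => x Ux; exists x. Qed.

Lemma fiber_le_trans (X : topologicalType) (E : X -> X -> Prop) (s t u : X) :
  (forall x y z, E x y -> E y z -> E x z) ->
  fiber_le E s t -> fiber_le E t u -> fiber_le E s u.
Proof.
move=> Et st tu U /st/tu; apply: filterS => z [y [x Ux xy] yz].
by exists x => //; exact: Et xy yz.
Qed.

Lemma fiber_le_homeo (X Y : topologicalType) (f : X -> Y) (g : Y -> X)
    (E : X -> X -> Prop) (D : Y -> Y -> Prop) (s t : X) :
  cancel f g -> cancel g f -> continuous f -> continuous g ->
  (forall x y, E x y -> D (f x) (f y)) ->
  fiber_le E s t -> fiber_le D (f s) (f t).
Proof.
move=> fK gK cf cg ED st U fsU.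
have /st tU := cf s _ fsU.
have : nbhs (f t) (g @^-1` [set y | exists2 x, U (f x) & E x y]).
  by apply: cg; rewrite fK.
apply: filterS => y [x Ux /ED]; rewrite gK => xy.
by exists (f x).
Qed.

(** Boxes of neighborhoods form a filter that converges to [x] coordinate by
coordinate, hence converges to [x]. *)
Lemma nbhs_box (I : eqType) (X : I -> topologicalType) (x : prod_topology X) U :
  nbhs x U -> exists2 B : forall i, set (X i),
    forall i, nbhs (x i) (B i) & forall y, (forall i, B i (y i)) -> U y.
Proof.
pose D := [set B : forall i, set (X i) | forall i, nbhs (x i) (B i)].
pose box (B : forall i, set (X i)) := [set y | forall i, B i (y i)].
have FF : Filter (filter_from D box).
  apply: filter_from_filter; first by exists (fun=> setT) => i; exact: filterT.
  move=> A B DA DB; exists (fun i => A i `&` B i) => [i|y yAB].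
    by apply: filterI; [exact: DA|exact: DB].
  by split=> i; have [] := yAB i.
suff /(_ U) FU : filter_from D box --> x.
  by move=> /FU[B DB BU]; exists B => // y yB; exact: BU.
apply/cvg_sup => i V; rewrite nbhsE => -[_ [[W oW <-] Wx] WV].
exists (dfwith (fun=> setT) i W) => [j|y yB].
  by case: dfwithP => [|k ik]; [exact: open_nbhs_nbhs|exact: filterT].
by apply: WV; have := yB i; rewrite dfwithin.
Qed.

(** Saturation by a product relation turns boxes into boxes. In one direction
this computes the saturation of a box; in the other, neighborhoods in a
factor are recovered along the embedding that varies a single coordinate. *)
Lemma fiber_le_prod (I : finType) (X : I -> topologicalType)
    (E : forall i, X i -> X i -> Prop) (s t : prod_topology X) :
  fiber_le (prod_rel E : prod_topology X -> prod_topology X -> Prop) s t <->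
  forall i, fiber_le (E i) (s i) (t i).
Proof.
split=> [st i U sU|st U /nbhs_box[B sB BU]].
  have /st tU : nbhs s (proj i @^-1` U) by exact: proj_continuous.
  have tE : dfwith t i (t i) = t.
    by apply: functional_extensionality_dep => j; case: dfwithP.
  have := @dfwith_continuous _ X t i (t i); rewrite /continuous_at tE.
  move=> cd; have : nbhs (t i) (dfwith t i @^-1` _) := cd _ tU.
  apply: filterS => y [x /= Ux xy].
  by exists (x i) => //; have := xy i; rewrite dfwithin.
pose W i := [set y | exists2 x, B i x & E i x y].
have tB : nbhs t [set y | forall i, W i (y i)].
  apply: (@filter_forall _ I (fun i => proj i @^-1` W i) (nbhs t)) => i.
  by have /st := sB i; exact: (@proj_continuous I X i t).
apply: filterS tB => y /= /(_ _)/cid2 yB.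
exists (fun i => sval (yB i)); first by apply: BU => i; case: (yB i).
by move=> i; case: (yB i).
Qed.

(** By totality, the point [e] in the second clause lies below its whole
fiber; the clause says that nothing else is equivalent to it. *)
Definition linear_fibers (X : topologicalType) (E : X -> X -> Prop) :=
  (forall s t, E s t -> fiber_le E s t \/ fiber_le E t s) /\
  (forall x, exists2 e, E x e & forall t, E x t -> fiber_le E t e -> t = e).

(** The preorder on a fiber of the product is seen in two ways: as a product
of [m] preorders in which some element lies strictly above the least one, and
as a product of [n] total preorders. *)
Lemma product_factors_le (K : topologicalType) (n m : nat)
    (L : 'I_m -> topologicalType)
    (f : prod_topology L -> power K n) (g : power K n -> prod_topology L)
    (E : K -> K -> Prop) (F : forall i, L i -> L i -> Prop) :
  cancel f g -> cancel g f -> continuous f -> continuous g ->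
  (forall x, E x x) -> (forall x y, E x y -> E y x) ->
  (forall x y z, E x y -> E y z -> E x z) ->
  linear_fibers E ->
  (forall x y, prod_rel F x y <-> prod_rel (fun=> E) (f x) (f y)) ->
  (forall i, exists p q, p <> q /\ F i p q) ->
  (m <= n)%N.
Proof.
move=> fK gK cf cg Er Es Et [Etot Emin] FE nF.
pose EE : power K n -> power K n -> Prop := prod_rel (fun=> E).
pose FF : prod_topology L -> prod_topology L -> Prop := prod_rel F.
have FFr x : FF x x by apply/FE => k.
have FFs x y : FF x y -> FF y x by move=> /FE xy; apply/FE => k; exact: Es.
have FFt x y z : FF x y -> FF y z -> FF x z.
  by move=> /FE xy /FE yz; apply/FE => k; exact: Et (xy k) (yz k).
have leE s t : fiber_le FF s t <-> fiber_le EE (f s) (f t).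
  split=> [|fst]; first by apply: (fiber_le_homeo fK gK cf cg) => x y /FE.
  rewrite -[s]fK -[t]fK; apply: (fiber_le_homeo gK fK cg cf _ fst) => x y xy.
  by apply/FE; rewrite !gK.
pose p : prod_topology L := fun i => projT1 (cid (nF i)).
have pq i : exists q, p i <> q /\ F i (p i) q by exact: projT2 (cid (nF i)).
have Fr i (x : L i) : F i x x by have := FFr (dfwith p i x) i; rewrite dfwithin.
have FleF i (x : L i) : fiber_le (F i) x x by apply: fiber_le_refl.
pose e' k := s2val (cid2 (Emin (f p k))).
have pe' k : E (f p k) (e' k) by exact: s2valP (cid2 (Emin (f p k))).
have e'min k t : E (f p k) t -> fiber_le E t (e' k) -> t = e' k.
  exact: s2valP' (cid2 (Emin (f p k))) t.
pose e := g e'.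
have pe : FF p e by apply/FE => k; rewrite gK.
have emin t : FF p t -> fiber_le FF t e -> t = e.
  move=> /FE pt /leE; rewrite gK => /fiber_le_prod te.
  rewrite -[t]fK; congr g; apply: functional_extensionality_dep => k.
  exact: e'min.
have eleast t : FF e t -> fiber_le FF e t.
  move=> et; apply/leE; rewrite gK; apply/fiber_le_prod => k.
  have e't : E (e' k) (f t k) by move/FE : et => /(_ k); rewrite gK.
  have [//|/e'min ->] := Etot _ _ e't; last exact: Et (pe' k) e't.
  exact: fiber_le_refl.
(* One of two different points of the fiber is not the least one. *)
have aP i : exists a, a <> e i /\ F i (e i) a.
  have [pei|] := pselect (p i = e i); last first.
    by exists (p i); split=> //; exact: FFs pe i.
  have [q [pq' Fq]] := pq i; exists q; split; first by rewrite -pei => /esym.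
  by rewrite -pei.
pose a i := projT1 (cid (aP i)).
have [ae ea] : (forall i, a i <> e i) /\ (forall i, F i (e i) (a i)).
  by split=> i; have [] := projT2 (cid (aP i)).
have lea i : fiber_le (F i) (e i) (a i).
  have /eleast/fiber_le_prod/(_ i) : FF e (dfwith e i (a i)).
    by move=> j; case: dfwithP.
  by rewrite dfwithin.
(* [d i] is the atom at [i] and [c i] is its complement. *)
pose c i : prod_topology L := fun j => if j == i then e j else a j.
pose d i : prod_topology L := dfwith e i (a i).
have ec i : FF e (c i) by move=> j; rewrite /c; case: ifP.
have ed i : FF e (d i) by move=> j; rewrite /d; case: dfwithP.
have kP i : exists k, ~ fiber_le E (f (d i) k) (f (c i) k).
  apply/existsNP => dc.
  have {dc}/fiber_le_prod/(_ i) : fiber_le FF (d i) (c i).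
    by apply/leE/fiber_le_prod.
  rewrite /d /c dfwithin eqxx => aei.
  suff de : d i = e by apply: (ae i); rewrite -[in RHS]de /d dfwithin.
  apply: emin; first exact: FFt pe (ed i).
  by apply/fiber_le_prod => j; rewrite /d; case: dfwithP.
have [k {}kP] := choice kP.
(* If [k i = k j] then, in that coordinate, [d j <= c i < d i <= c j], which
   contradicts the choice of [k j]. *)
have k_inj : injective k.
  move=> i j kij; apply/eqP/negP => /negP ij.
  have dc i1 i2 : i1 != i2 -> fiber_le FF (d i1) (c i2).
    move=> i12; apply/fiber_le_prod => l; rewrite /d /c.
    case: dfwithP => [|l' i1l]; first by rewrite (negbTE i12).
    by case: ifP.
  have /leE/fiber_le_prod/(_ (k j)) dji : fiber_le FF (d j) (c i).
    by apply: dc; rewrite eq_sym.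
  have /leE/fiber_le_prod/(_ (k j)) dij := dc _ _ ij.
  have : E (f (d i) (k j)) (f (c i) (k j)).
    by move: (k j); apply/FE; exact: FFt (FFs _ _ (ed i)) (ec i).
  move=> /Etot[|cd]; first by rewrite -kij; exact: kP.
  apply: (kP j); apply: (fiber_le_trans Et) dij.
  exact: (fiber_le_trans Et) dji cd.
by have := leq_card k k_inj; rewrite !card_ord.
Qed.

(** * Compactness and separating functions *)

(** Otherwise the finite intersections of the [C i] outside [O] generate a
proper filter, and a cluster point of it lies in every [C i] but not in [O]. *)
Lemma compact_bigcap_sub (Z : topologicalType) (I : choiceType)
    (C : I -> set Z) (O : set Z) :
  compact [set: Z] -> (forall i, closed (C i)) -> open O ->
  \bigcap_i C i `<=` O ->
  exists F : {fset I}, \bigcap_(i in [set` F]) C i `<=` O.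
Proof.
move=> cZ cC oO CO; apply: contrapT => nF.
pose B (F : {fset I}) := \bigcap_(i in [set` F]) C i `&` ~` O.
have B0 F : B F !=set0.
  apply: contrapT => BF; apply: nF; exists F => z Cz.
  by apply: contrapT => Oz; apply: BF; exists z.
have FF : ProperFilter (filter_from [set: {fset I}] B).
  apply: filter_from_proper => [|F _]; last exact: B0.
  apply: filter_from_filter; first by exists fset0.
  move=> F1 F2 _ _; exists (F1 `|` F2)%fset => // z [Cz Oz].
  by split; split=> // i Fi; apply: Cz => /=; rewrite inE Fi ?orbT.
have [|z [_ clz]] := cZ _ FF; first exact: filterT.
have Oz : O z.
  apply: CO => i _; apply: cC => U zU.
  apply: clz zU; exists [fset i]%fset => // y [+ _].
  by apply => /=; rewrite inE.
have [|y [[_ nOy] Oy]] := clz (B fset0) O _ (open_nbhs_nbhs (conj oO Oz)).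
  by exists fset0.
exact: nOy.
Qed.

Section separating.
Variables (R : realType) (X : topologicalType) (J : choiceType).
Variable phi : J -> X -> R.
Hypothesis phi_cont : forall j, continuous (phi j).

Definition close_on (F : {fset J}) (e : R) (x y : X) :=
  forall j, j \in F -> `|phi j x - phi j y| < e.

Lemma close_on_nbhs F e x : 0 < e -> nbhs x [set y | close_on F e x y].
Proof.
move=> e0.
have : nbhs x (\bigcap_(j in [set` F]) [set y | `|phi j x - phi j y| < e]).
  apply: filter_bigI => j _.
  have : nbhs x (phi j @^-1` ball (phi j x) e).
    by apply: phi_cont; exact: nbhsx_ballx.
  by apply: filterS.
by apply: filterS => y xy j /xy.
Qed.

Hypothesis phi_sep : forall x y, (forall j, phi j x = phi j y) -> x = y.
Hypothesis X_compact : compact [set: X].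

(** A compact topology is no finer than the one induced by a separating family
of continuous functions. *)
Lemma nbhs_close_on x U : nbhs x U ->
  exists F, exists2 e, 0 < e & forall y, close_on F e x y -> U y.
Proof.
rewrite nbhsE => -[V [oV Vx] VU].
pose C (p : J * nat) := [set y | `|phi p.1 x - phi p.1 y| <= p.2.+1%:R^-1].
have cC p : closed (C p).
  apply: (@preimage_closed _ _ (fun y => `|phi p.1 x - phi p.1 y|)
    [set t | t <= p.2.+1%:R^-1]); last exact: closed_le.
  move=> y _; apply: cvg_norm; apply: cvgB; first exact: cvg_cst.
  exact: phi_cont.
have CV : \bigcap_p C p `<=` V.
  move=> y Cy; rewrite (_ : y = x)//; apply: phi_sep => j.
  apply/esym/eqP; rewrite -subr_eq0 -normr_le0 leNgt; apply/negP.
  move=> /ltr_add_invr[k]; rewrite add0r ltNge.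
  by rewrite (Cy (j, k)).
have [F FV] := compact_bigcap_sub X_compact cC oV CV.
exists [fset p.1 | p in F]%fset, (\max_(p <- F) p.2).+1%:R^-1.
  by rewrite invr_gt0.
move=> y xy; apply/VU/FV => -[j k] /= Fjk; rewrite /C/=.
have /xy/ltW/le_trans : j \in [fset p.1 | p in F]%fset.
  by apply/imfsetP; exists (j, k).
apply; rewrite lef_pV2 ?posrE// ler_nat ltnS.
exact: (@leq_bigmax_seq _ (enum_fset F) xpredT snd (j, k) Fjk isT).
Qed.

Lemma fiber_le_close (E : X -> X -> Prop) s t :
  (forall F e, 0 < e ->
     nbhs t [set t' | exists2 s', close_on F e s s' & E s' t']) ->
  fiber_le E s t.
Proof.
move=> st U /nbhs_close_on[F [e e0 FU]].
by apply: filterS (st F e e0) => t' [s' /FU Us' s't']; exists s'.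
Qed.

End separating.

(** By compactness, the finite intersections of preimages of open intervals
with rational endpoints form a base. *)
Lemma second_countable_separating (R : realType) (X : topologicalType)
    (J : Type) (A : set J) (phi : J -> X -> R) :
  compact [set: X] -> countable A -> (forall j, continuous (phi j)) ->
  (forall x y, (forall j, A j -> phi j x = phi j y) -> x = y) ->
  @second_countable X.
Proof.
move=> cX /countable_injP[h hinj] cphi sep.
(* The family, numbered along an injection of [A] into [nat]; unused numbers
   get the zero function. *)
pose f n : X -> R := if pselect (exists j, A j /\ h j = n) is left e
  then phi (projT1 (cid e)) else cst 0.
have cf n : continuous (f n).
  rewrite /f; case: pselect => [e|_]; first exact: cphi.
  by move=> x; exact: cvg_cst.
have fsep x y : (forall n, f n x = f n y) -> x = y.
  move=> fxy; apply: sep => j Aj; have := fxy (h j).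
  rewrite /f; case: pselect => [e|]; last by case; exists j.
  case: (cid e) => /= i [Ai hij]; rewrite (_ : i = j)//.
  by apply: hinj => //; rewrite inE.
pose T := (nat * rat * rat)%type.
pose inside (x : X) (t : T) :=
  (ratr t.1.2 < f t.1.1 x) && (f t.1.1 x < ratr t.2).
pose O (s : {fset T}) := \bigcap_(t in [set` s]) [set y | inside y t].
have oO s : open (O s).
  rewrite openE => x Ox; apply: filter_bigI => -[[n a] b] /Ox /andP[/= ax xb].
  have : nbhs x (f n @^-1` `]ratr a, ratr b[).
    apply: cf; apply: open_nbhs_nbhs; split; first exact: itv_open.
    by rewrite /= in_itv/= ax.
  by apply: filterS => y /=; rewrite in_itv.
exists (range O).
  by apply: sub_countable (card_image_le _ _) _; exact: countableP.
split=> [_ [s _ <-]|x U]; first exact: oO.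
rewrite nbhsE => -[V [oV Vx] VU].
pose C (t : T) := if inside x t then
  [set y | ratr t.1.2 <= f t.1.1 y <= ratr t.2] else setT.
have cC t : closed (C t).
  rewrite /C; case: ifP => _; last exact: closedT.
  apply: (@preimage_closed _ _ (f t.1.1) `[ratr t.1.2, ratr t.2]).
    by move=> y _; exact: cf.
  exact: itv_closed.
have CV : \bigcap_t C t `<=` V.
  move=> y Cy; rewrite (_ : y = x)//; apply: fsep => n.
  have [|a] := @rat_in_itvoo R (f n x - 1) (f n x).
    by rewrite ltrBlDr ltrDl.
  rewrite in_itv/= => /andP[_ ax].
  have [|b] := @rat_in_itvoo R (f n x) (f n x + 1).
    by rewrite ltrDl.
  rewrite in_itv/= => /andP[xb _].
  apply/eqP; rewrite eq_le !leNgt; apply/andP; split; apply/negP => /rat_in_itvoo[q].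
    rewrite in_itv/= => /andP[xq qy].
    have := Cy (n, a, q) I; rewrite /C /inside/= ax xq /= => /andP[_].
    by rewrite leNgt qy.
  rewrite in_itv/= => /andP[yq qx].
  have := Cy (n, q, b) I; rewrite /C /inside/= qx xb /= => /andP[].
  by rewrite leNgt yq.
have [F FV] := compact_bigcap_sub cX cC oV CV.
exists (O [fset t in F | inside x t]%fset); first split.
- by exists [fset t in F | inside x t]%fset.
- by move=> t /=; rewrite !inE => /andP[_ ->].
- move=> y Oy; apply/VU/FV => t /= Ft; rewrite /C; case: ifPn => // xt.
  have /Oy/andP[/= /ltW -> /ltW ->] // : t \in [fset t in F | inside x t]%fset.
  by rewrite !inE Ft.
Qed.

(** Each condition [`|d' j z| < 1 / (k + 1)] defines an open set containing
the intersection of the closed sets [d j z = 0], hence already the intersection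
of finitely many of them. *)
Lemma countable_refinement (R : realType) (Z : topologicalType) (J J' : choiceType)
    (d : J -> Z -> R) (d' : J' -> Z -> R) (A : set J') :
  compact [set: Z] ->
  (forall j, continuous (d j)) -> (forall j, continuous (d' j)) ->
  (forall z, (forall j, d j z = 0) -> forall j, d' j z = 0) ->
  countable A -> exists2 B : set J, countable B &
    forall z, (forall j, B j -> d j z = 0) -> forall j, A j -> d' j z = 0.
Proof.
move=> cZ cd cd' dd' cA.
have FP (p : J' * nat) : exists F : {fset J},
    forall z, (forall j, j \in F -> d j z = 0) -> `|d' p.1 z| < p.2.+1%:R^-1.
  have [|||F FO] := @compact_bigcap_sub Z J (fun j => d j @^-1` [set 0])
    [set z | `|d' p.1 z| < p.2.+1%:R^-1] cZ.
  - move=> j; apply: preimage_closed; first by move=> z _; exact: cd.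
    exact: closed_eq.
  - apply: (@open_comp _ _ (fun z => `|d' p.1 z|) [set t | t < p.2.+1%:R^-1]).
      by move=> z _; apply: cvg_norm; exact: cd'.
    exact: open_lt.
  - by move=> z dz /=; rewrite dd' ?normr0 ?invr_gt0// => j; exact: dz.
  - by exists F => z dz; exact: FO.
have [F FE] := choice FP.
exists (\bigcup_(p in A `*` [set: nat]) [set` F p]).
  apply: bigcup_countable => [|p _]; first exact: countableX.
  exact/finite_set_countable/finite_fset.
move=> z dz j Aj; apply/eqP; rewrite -normr_le0 leNgt; apply/negP.
move=> /ltr_add_invr[k]; rewrite add0r ltNge => /negP; apply.
apply/ltW/(FE (j, k)) => i Fi; apply: dz.
by exists (j, k).
Qed.

(** * Countable quotients and the counting argument *)

Definition agree (R : realType) (X J : Type) (phi : J -> X -> R) (A : set J)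
  (x y : X) := forall j, A j -> phi j x = phi j y.

(** [G] is the class of index sets whose quotients have linear fibers. It is
cofinal among countable sets and closed under countable unions, so that
closing-off constructions can be made to end in [G]. *)
Definition linear_quotients (R : realType) (K : topologicalType) :=
  exists (J : choiceType) (phi : J -> K -> R) (G : set (set J)),
    [/\ (forall j, continuous (phi j)),
        (forall x y, (forall j, phi j x = phi j y) -> x = y),
        (forall A, G A -> countable A),
        (forall A, countable A -> exists2 B, G B & A `<=` B) &
        (forall A : nat -> set J, (forall k, G (A k)) -> G (\bigcup_k A k)) /\
        (forall A, G A -> linear_fibers (agree phi A))].

(** The refinements demanded by [P] exist for countable sets; going through
[G] at each step keeps the sets countable, and the union stays in [G]. *)
Lemma closing_off (J : Type) (G : set (set J)) (P : set J -> set J -> Prop) :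
  (forall A, G A -> countable A) ->
  (forall A : nat -> set J, (forall k, G (A k)) -> G (\bigcup_k A k)) ->
  (forall A, countable A -> exists2 B, G B & P A B) ->
  exists2 A : nat -> set J, (forall k, P (A k) (A k.+1)) & G (\bigcup_k A k).
Proof.
move=> Gc GU GP.
have /choice[r rP] A : exists B, countable A -> G B /\ P A B.
  have [/GP[B GB PAB]|nA] := pselect (countable A); last by exists set0.
  by exists B.
pose A k := iter k.+1 r set0.
have GA k : G (A k).
  elim: k => [|k IH]; first by have [] := rP set0 (@countable0 _).
  by have [] := rP _ (Gc _ IH).
exists A => [k|]; last exact: GU.
by have [] := rP _ (Gc _ (GA k)).
Qed.

Lemma prod_compact (I : eqType) (L : I -> topologicalType) :
  (forall i, compact [set: L i]) -> compact [set: prod_topology L].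
Proof.
move=> cL; have := @tychonoff I L (fun=> setT) cL.
by congr (@compact (prod_topology L) _); apply/seteqP; split.
Qed.

(** Alternating between the index sets that refine the product structure of
[K^n] and those that refine the product of the [L i], one reaches a countable
set [U] for which agreement on [U] is a product relation on both sides. *)
Lemma linear_quotients_factors (R : realType) (K : topologicalType) (n m : nat)
    (L : 'I_m -> topologicalType) :
  linear_quotients R K ->
  (forall i, compact [set: L i]) -> (forall i, uncountable_weight (L i)) ->
  homeomorphic (power K n) (prod_topology L) -> (m <= n)%N.
Proof.
move=> [J [phi [G [cphi sep Gc Gcof [GU Glin]]]]] cL wL [g [f [gK fK cg cf]]].
pose X := prod_topology L.
have cX : compact [set: X] by exact: prod_compact.
have L0 i : exists x : L i, True.
  apply: contrapT => nL; apply: (wL i); exists set0; first exact: countable0.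
  by split=> // x; case: nL; exists x.
pose p : X := fun i => projT1 (cid (L0 i)).
(* [ins i] embeds [L i] into the product, through the base point [p]. *)
pose ins i (u : L i) : X := dfwith p i u.
have cins i : continuous (ins i) by exact: dfwith_continuous.
have ccoord j k : continuous (fun x : X => phi j (f x k)).
  move=> x; apply: (@continuous_comp _ _ _ f (fun y => phi j (y k))); first exact: cf.
  apply: (@continuous_comp (power K n) K R (fun y => y k) (phi j)).
    exact: proj_continuous.
  exact: cphi.
(* Vanishing of [d j] expresses agreement on the index [j] in all coordinates
   of [K^n]; [d' j] does the same separately on each factor [L i]. Both
   families separate points, so each refines the other countably. *)
pose d j (z : X * X) : R := \sum_(k < n) `|phi j (f z.1 k) - phi j (f z.2 k)|.
pose d' j (z : X * X) : R := \sum_(i < m) d j (ins i (z.1 i), ins i (z.2 i)).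
have cd j : continuous (d j).
  apply: continuous_big => [|k _ z]; first exact: add_continuous.
  apply: cvg_norm; apply: cvgB.
    apply: (@continuous_comp (X * X)%type X R fst (fun x : X => phi j (f x k))).
      exact: cvg_fst.
    exact: ccoord.
  apply: (@continuous_comp (X * X)%type X R snd (fun x : X => phi j (f x k))).
    exact: cvg_snd.
  exact: ccoord.
have cd' j : continuous (d' j).
  apply: continuous_big => [|i _ z]; first exact: add_continuous.
  apply: (@continuous_comp (X * X)%type (X * X)%type R
    (fun z => (ins i (z.1 i), ins i (z.2 i))) (d j)); last exact: cd.
  apply: (@cvg_pair (X * X)%type X X (nbhs z) (nbhs (ins i (z.1 i)))
    (nbhs (ins i (z.2 i))) _ _ _ (fun z => ins i (z.1 i)) (fun z => ins i (z.2 i))).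
    apply: (@continuous_comp _ _ _ (fun z : X * X => z.1 i) (ins i)); last exact: cins.
    apply: (@continuous_comp (X * X)%type X (L i) fst (fun x : X => x i)).
      exact: cvg_fst.
    exact: proj_continuous.
  apply: (@continuous_comp _ _ _ (fun z : X * X => z.2 i) (ins i)); last exact: cins.
  apply: (@continuous_comp (X * X)%type X (L i) snd (fun x : X => x i)).
    exact: cvg_snd.
  exact: proj_continuous.
have d0 j x y : d j (x, y) = 0 <-> forall k, phi j (f x k) = phi j (f y k).
  split=> [/eqP|xy]; last by apply: big1 => k _; rewrite /= xy subrr normr0.
  rewrite psumr_eq0// => /allP dxy k; apply/eqP.
  by have := dxy k (mem_index_enum k); rewrite /= normr_eq0 subr_eq0.
have d'0 j x y : d' j (x, y) = 0 <-> forall i, d j (ins i (x i), ins i (y i)) = 0.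
  split=> [/eqP|xy]; last by apply: big1 => k _; rewrite /= xy.
  rewrite psumr_eq0 => [/allP dxy i|i _]; last by rewrite sumr_ge0.
  by apply/eqP; have := dxy i (mem_index_enum i).
have dsep x y : (forall j, d j (x, y) = 0) -> x = y.
  move=> dxy; rewrite -[x]fK -[y]fK; congr g; apply: functional_extensionality_dep.
  by move=> k; apply: sep => j; move/d0 : (dxy j).
have dd j x : d j (x, x) = 0 by apply/d0.
have dd' z : (forall j, d j z = 0) -> forall j, d' j z = 0.
  by case: z => x y /dsep -> j; apply/d'0.
have d'd z : (forall j, d' j z = 0) -> forall j, d j z = 0.
  case: z => x y d'xy j; rewrite (_ : x = y)//.
  apply: functional_extensionality_dep => i.
  suff : ins i (x i) = ins i (y i) by move/(congr1 (@^~ i)); rewrite /ins !dfwithin.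
  by apply: dsep => j'; move/d'0 : (d'xy j').
have cXX : compact [set: X * X] by rewrite -setXTT; exact: compact_setX.
pose zero (e : J -> X * X -> R) (A : set J) z := forall j, A j -> e j z = 0.
have [|A AP GA] := @closing_off J G (fun A B =>
    (forall z, zero d B z -> zero d' A z) /\
    (forall z, zero d' B z -> zero d A z)) Gc GU.
  move=> A cA.
  have [B1 cB1 B1P] := countable_refinement cXX cd cd' dd' cA.
  have [B2 cB2 B2P] := countable_refinement cXX cd' cd d'd cA.
  pose C k := if k is 0%N then B1 else B2.
  have [|B GB AB] := Gcof (\bigcup_k C k).
    by apply: bigcup_countable => // -[|k] _.
  exists B => //; split=> z Bz; [apply: B1P|apply: B2P] => j Bj; apply: Bz; apply: AB.
    by exists 0%N.
  by exists 1%N.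
set U := \bigcup_k A k in GA.
have dU z : zero d U z <-> zero d' U z.
  split=> Uz j [k _ Akj]; have [P1 P2] := AP k; [apply: P1 Akj|apply: P2 Akj] => i Ai;
    by apply: Uz; exists k.+1.
pose F i (u v : L i) := forall j, U j -> d j (ins i u, ins i v) = 0.
apply: (@product_factors_le K n m L f g (agree phi U) F) => //.
- by move=> x y xy j Uj; rewrite xy.
- by move=> x y z xy yz j Uj; rewrite xy// yz.
- exact: Glin.
- move=> x y; split.
    move=> xy k j Uj; move: k; apply/d0; move: j Uj; apply/dU => j Uj.
    by apply/d'0 => i; exact: xy.
  move=> xy i j Uj; move: i; apply/d'0; move: j Uj; apply/dU => j Uj.
  by apply/d0 => k; exact: xy.
- move=> i; apply: contrapT => nF; apply: (wL i).
  have FE u v : F i u v -> u = v.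
    by move=> uv; apply: contrapT => nuv; apply: nF; exists u, v.
  apply: (@second_countable_separating R (L i) ('I_n * J)%type ([set: 'I_n] `*` U)
    (fun q u => phi q.2 (f (ins i u) q.1))) => //.
  + by apply: countableX => //; exact: Gc.
  + move=> [k j] u.
    apply: (@continuous_comp (L i) X R (ins i) (fun x : X => phi j (f x k))).
      exact: cins.
    exact: ccoord.
  + by move=> u v uv; apply: FE => j Uj; apply/d0 => k; exact: (uv (k, j)).
Qed.

Lemma homeomorphic_power_compact (K : topologicalType) (n m : nat)
    (L : 'I_m -> topologicalType) :
  (1 <= n)%N -> (forall i, compact [set: L i]) ->
  homeomorphic (power K n) (prod_topology L) -> compact [set: K].
Proof.
case: n => // n _ cL [g [f [gK fK cg cf]]].
have cX : compact [set: prod_topology L] by exact: prod_compact.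
pose h (x : prod_topology L) : K := f x ord0.
have ch : continuous h.
  move=> x.
  apply: (@continuous_comp (prod_topology L) (power K n.+1) K f (fun y => y ord0)).
    exact: cf.
  exact: proj_continuous.
have -> : [set: K] = h @` [set: prod_topology L].
  apply/seteqP; split => // y _.
  by exists (g (fun=> y)) => //; rewrite /h gK.
apply: continuous_compact => //.
exact: continuous_subspaceT.
Qed.

(** * Balls of square-summable families *)

Lemma ler_sum_fsubset (R : realType) (J : choiceType) (F F' : {fset J})
    (P Q : pred J) (f : J -> R) :
  (F `<=` F')%fset -> (forall j, P j -> Q j) -> (forall j, 0 <= f j) ->
  \sum_(j <- F | P j) f j <= \sum_(j <- F' | Q j) f j.
Proof.
move=> /fsubsetP FF' PQ f0.
have -> : \sum_(j <- F | P j) f j = \sum_(j <- F' | (j \in F) && P j) f j.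
  rewrite -big_filter -[RHS]big_filter; apply: perm_big; apply: uniq_perm.
  - exact/filter_uniq/fset_uniq.
  - exact/filter_uniq/fset_uniq.
  - move=> j; rewrite !mem_filter.
    by case: (P j); rewrite ?andbF//= andbT; have [/FF' ->|] := boolP (j \in F).
rewrite big_mkcond [leRHS]big_mkcond; apply: ler_sum => j _.
case: ifPn => [/andP[_ /PQ ->]//|_]; by case: ifP.
Qed.

(** The model: a compact space of functions [a : J -> R] with values in [C]
and squares of sum at most 1. Both [C = R] and the nonnegative reals occur. *)
Section ball.
Variables (R : realType) (K : topologicalType) (J : choiceType).
Variables (phi : J -> K -> R) (C : set R).
Hypothesis K_compact : compact [set: K].
Hypothesis phi_cont : forall j, continuous (phi j).
Hypothesis phi_sep : forall x y, (forall j, phi j x = phi j y) -> x = y.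
Hypothesis C_scale : forall r c : R, 0 <= r <= 1 -> C c -> C (r * c).
Hypothesis C_ge0 : forall c : R, 0 <= c -> C c.
Hypothesis phi_C : forall j x, C (phi j x).
Hypothesis phi_ball : forall x (F : {fset J}), \sum_(j <- F) phi j x ^+ 2 <= 1.
Hypothesis phi_onto : forall a : J -> R, (forall j, C (a j)) ->
  (forall F : {fset J}, \sum_(j <- F) a j ^+ 2 <= 1) ->
  exists x, forall j, phi j x = a j.

Let phi_le1 j x : `|phi j x| <= 1.
Proof.
have := phi_ball x [fset j]%fset; rewrite big_seq_fset1 => h.
by rewrite -(@ler_pXn2r _ 2)// ?nnegrE// expr1n real_normK// num_real.
Qed.

(** Comparison of the sums of squares outside [A], these sums being suprema
over finite sets. *)
Let off_le (A : set J) s t := forall (F : {fset J}) (e : R), 0 < e -> exists F' : {fset J},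
  \sum_(j <- F | j \notin A) phi j s ^+ 2 <
  \sum_(j <- F' | j \notin A) phi j t ^+ 2 + e.

Let off_le_total A s t : off_le A s t \/ off_le A t s.
Proof.
have [|nst] := pselect (off_le A s t); first by left.
right => F' e e0; apply: contrapT => nF'; apply: nst => F e' e'0.
exists F'; rewrite ltNge; apply/negP => F'F; apply: nF'; exists F.
rewrite (le_lt_trans (le_trans _ F'F))//; first by rewrite lerDl ltW.
by rewrite ltrDl.
Qed.

(** Given [t'] close to [t], keep its coordinates in [A] and replace the
others by those of [s] on [F], slightly shrunk. What [t'] carries outside [A]
nearly reaches what [t] does, hence is at least the shrunk part of [s], and
the new family stays in the ball. *)
Let fiber_le_off A s t :
  agree phi A s t -> off_le A s t -> fiber_le (agree phi A) s t.
Proof.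
move=> st lest; apply: (fiber_le_close phi_cont phi_sep K_compact) => F e e0.
pose D : R := Num.min e 1 / 2.
have D0 : 0 < D by rewrite divr_gt0// lt_min e0 ltr01.
have D1 : D < 1.
  by rewrite ltr_pdivrMr// mul1r gt_min ltr1n orbT.
have De : D < e.
  by rewrite ltr_pdivrMr// mulr_natr mulr2n gt_min ltrDl e0.
pose r := 1 - D.
have r01 : 0 <= r <= 1 by rewrite subr_ge0 ltW//= lerBlDr lerDl ltW.
pose S := \sum_(j <- F | j \notin A) phi j s ^+ 2.
pose T F1 t' := \sum_(j <- F1 | j \notin A) phi j t' ^+ 2.
have S0 : 0 <= S by apply: sumr_ge0 => j _; exact: sqr_ge0.
(* [F1] captures enough of the sum of [t] to dominate the shrunk part of [s];
   if that part is zero, the empty set does. *)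
have [F1 tF1] : exists F1 : {fset J}, nbhs t [set t' | r ^+ 2 * S <= T F1 t'].
  have [S00|S_neq0] := eqVneq S 0.
    exists fset0; apply: nearW => t'.
    by rewrite S00 mulr0; apply: sumr_ge0 => j _; exact: sqr_ge0.
  have rS : r ^+ 2 * S < S.
    rewrite gtr_pMl; last by rewrite lt_neqAle eq_sym S_neq0.
    by rewrite exprn_ilt1// ?(andP r01).1// /r ltrBlDr ltrDl.
  have [|F1] := lest F (S - r ^+ 2 * S); first by rewrite subr_gt0.
  rewrite -/S -/(T F1 t) -ltrBlDr opprB addrCA subrr addr0 => ltT.
  exists F1.
  have cT : continuous (T F1).
    apply: continuous_big => [|j _ u]; first exact: add_continuous.
    by apply: cvgM; exact: phi_cont.
  have : nbhs t (T F1 @^-1` [set c | r ^+ 2 * S < c]).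
    by apply: cT; apply: open_nbhs_nbhs; split => //; exact: open_gt.
  by apply: filterS => t' /ltW.
apply: filterS2 (close_on_nbhs phi_cont F t e0) tF1 => t' tt' rSt'.
pose a j := if j \in A then phi j t' else if j \in F then r * phi j s else 0.
have aC j : C (a j).
  by rewrite /a; case: ifP => // _; case: ifP => _; [exact: C_scale|exact: C_ge0].
have aB (F2 : {fset J}) : \sum_(j <- F2) a j ^+ 2 <= 1.
  apply: le_trans (phi_ball t' (F1 `|` F2)%fset).
  rewrite (bigID (mem A)) [leRHS](bigID (mem A))/= lerD//.
    rewrite (eq_bigr (fun j => phi j t' ^+ 2)) => [|j jA]; last by rewrite /a jA.
    by apply: ler_sum_fsubset => // [|j]; [exact: fsubsetUr|exact: sqr_ge0].
  apply: (@le_trans _ _ (T F1 t')); last first.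
    by apply: ler_sum_fsubset => // [|j]; [exact: fsubsetUl|exact: sqr_ge0].
  apply: le_trans rSt'; rewrite /S mulr_sumr.
  pose b j := if j \in F then (r * phi j s) ^+ 2 else 0.
  have b0 j : 0 <= b j by rewrite /b; case: ifP => // _; exact: sqr_ge0.
  rewrite (eq_bigr b) => [|j /negbTE jA]; last first.
    by rewrite /a /b jA; case: ifP; rewrite // expr0n.
  rewrite [leRHS](_ : _ = \sum_(j <- F | j \notin A) b j); last first.
    rewrite big_seq_cond [RHS]big_seq_cond; apply: eq_bigr => j /andP[jF _].
    by rewrite /b jF exprMn.
  apply: (@le_trans _ _ (\sum_(j <- F `|` F2 | j \notin A) b j)%fset).
    by apply: ler_sum_fsubset => //; exact: fsubsetUr.
  rewrite (bigID (mem F))/= [X in _ + X]big1 ?addr0 => [|j /andP[_ /negbTE jF]];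
    last by rewrite /b jF.
  rewrite -big_filter -[leRHS]big_filter le_eqVlt; apply/orP; left; apply/eqP.
  apply: perm_big; apply: uniq_perm; rewrite ?filter_uniq ?fset_uniq//.
  move=> j; rewrite !mem_filter inE.
  by case: (j \in F); rewrite ?andbT ?andbF.
have [s' s'E] := phi_onto aC aB.
exists s' => [j jF|j jA]; last by rewrite s'E /a mem_set.
rewrite s'E /a; case: ifPn => [|_].
  by rewrite inE => jA; rewrite st//; exact: tt'.
rewrite jF -{1}[phi j s]mul1r -mulrBl /r opprB addrCA subrr addr0 normrM.
rewrite (gtr0_norm D0); apply: le_lt_trans De.
by rewrite ler_piMr// ltW.
Qed.

(** The least point [e] vanishes outside [A]. Near [e] there are points that
vanish outside [A] and lie on the sphere, because [A] is infinite: the missing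
norm is put on an index of [A] outside the finite set that defines the
neighborhood. Nothing in the fiber of such a point has a nonzero coordinate
outside [A]. *)
Let fiber_min A x : infinite_set A ->
  exists2 e, agree phi A x e &
    forall t, agree phi A x t -> fiber_le (agree phi A) t e -> t = e.
Proof.
move=> infA.
have [||e eE] := phi_onto (a := fun j => if j \in A then phi j x else 0).
- by move=> j; case: ifP => // _; exact: C_ge0.
- move=> F; apply: le_trans (phi_ball x F).
  by apply: ler_sum => j _; case: ifP => // _; rewrite expr0n/= sqr_ge0.
exists e => [j jA|t xt te]; first by rewrite eE mem_set.
have te_on j : A j -> phi j t = phi j e by move=> jA; rewrite eE mem_set// xt.
apply: contrapT => ne.
have [j tj0] : exists j, phi j t <> phi j e.
  by apply: contrapT => n; apply: ne; apply: phi_sep => j; apply: contrapT => ?;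
    apply: n; exists j.
have jA : j \notin A by apply/negP; rewrite inE => /te_on.
have {}tj0 : phi j t != 0 by apply/eqP; move: tj0; rewrite eE (negbTE jA).
have /te/(nbhs_close_on phi_cont phi_sep K_compact)[F [d d0 FU]] :
    nbhs t (phi j @^-1` [set c | c != 0]).
  by apply: phi_cont; apply: open_nbhs_nbhs; split => //; exact: open_neq.
have [a0 [a0A a0F]] : exists a0, A a0 /\ a0 \notin F.
  have [a0 [a0A a0F]] := infinite_setN0 (infinite_setD infA (finite_fset F)).
  by exists a0; split=> //; exact/negP.
pose S := \sum_(i <- F | i \in A) phi i e ^+ 2.
have S1 : S <= 1.
  by apply: le_trans (phi_ball e F); apply: ler_sum_fsubset => // i; exact: sqr_ge0.
pose a i := if (i \in F) && (i \in A) then phi i e else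
  if i == a0 then Num.sqrt (1 - S) else 0.
have aC i : C (a i).
  by rewrite /a; case: ifP => // _; case: ifP => _; exact: C_ge0.
have aE : \sum_(i <- (a0 |` F)%fset) a i ^+ 2 = 1.
  rewrite big_fsetU1//= {1}/a (negbTE a0F)/= eqxx sqr_sqrtr ?subr_ge0//.
  rewrite (bigID (mem A))/= [X in _ + (_ + X)]big_seq_cond.
  rewrite [X in _ + (_ + X)]big1 => [|i /andP[iF /negbTE iA]]; last first.
    rewrite /a iF iA/=; case: eqP => [ia0|_]; last by rewrite expr0n.
    by rewrite -ia0 iF in a0F.
  rewrite addr0 [X in _ + X](_ : _ = S) ?subrK//.
  rewrite big_seq_cond [RHS]big_seq_cond; apply: eq_bigr => i /andP[iF iA].
  by rewrite /a iF iA.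
have aB (F2 : {fset J}) : \sum_(i <- F2) a i ^+ 2 <= 1.
  rewrite -aE (bigID (mem (a0 |` F)%fset))/= [X in _ + X]big1 => [|i].
    rewrite addr0 -big_filter (_ : \sum_(i <- _) _ =
      \sum_(i <- [fset i in F2 | i \in a0 |` F]%fset) a i ^+ 2); last first.
      apply: perm_big; apply: uniq_perm; rewrite ?filter_uniq ?fset_uniq//.
      by move=> i; rewrite mem_filter !inE andbC.
    apply: ler_sum_fsubset => // [|i]; last exact: sqr_ge0.
    by apply/fsubsetP => i; rewrite !inE => /andP[].
  rewrite !inE negb_or => /andP[/negbTE ia0 /negbTE iF].
  by rewrite /a iF ia0 expr0n.
have [y yE] := phi_onto aC aB.
have [|u uj uy] := FU y.
  move=> i iF; rewrite yE /a iF/=; case: ifPn => iA; first by rewrite subrr normr0.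
  case: eqP => [ia0|_]; first by rewrite -ia0 iF in a0F.
  by rewrite eE (negbTE iA) subrr normr0.
have := phi_ball u (j |` (a0 |` F))%fset; apply/negP; rewrite -ltNge.
rewrite (bigD1_seq j) ?fset_uniq ?inE ?eqxx//= -[ltLHS]add0r -aE.
apply: ltr_leD; first by rewrite exprn_even_gt0.
rewrite (bigID (mem A))/= [X in _ + X]big_seq_cond [X in _ + X]big1 => [|i]; last first.
  rewrite !inE => /andP[/orP[/eqP ->|iF] iA]; first by rewrite mem_set in iA.
  rewrite /a iF (negbTE iA)/=; case: eqP => [ia0|_]; last by rewrite expr0n.
  by rewrite -ia0 iF in a0F.
rewrite addr0 (eq_bigr (fun i => phi i u ^+ 2)) => [|i /set_mem iA]; last first.
  by rewrite -yE (uy _ iA).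
apply: ler_sum_fsubset => [|i iA|i]; [exact: fsubsetUr| |exact: sqr_ge0].
by apply: contraNneq jA => <-.
Qed.

Lemma ball_linear_quotients : ~ countable [set: J] -> linear_quotients R K.
Proof.
move=> ncJ; exists J, phi, [set A | countable A /\ infinite_set A]; split => //.
- by move=> A [].
- move=> A cA.
  have infJ : infinite_set [set: J] by move=> /finite_set_countable.
  have /choice[F FP] n : exists F : {fset J}, (n <= #|` F|)%N.
    by have [F _ nF] := infinite_set_fset n infJ; exists F.
  exists (\bigcup_n (A `|` [set` F n])) => [|j]; last by exists 0%N => //; left.
  split.
    apply: bigcup_countable => // n _.
    rewrite -bigcup2E; apply: bigcup_countable => // -[//|[|k]] _ /=.
      exact/finite_set_countable/finite_fset.
    exact: countable0.
  set B := \bigcup_n _ => finB; pose N := #|` fset_set B|.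
  suff : (N < N)%N by rewrite ltnn.
  apply: (leq_trans (FP N.+1)); apply: fsubset_leq_card; apply/fsubsetP => j jF.
  by rewrite in_fset_set// inE; exists N.+1 => //; right.
- split=> [A AG|A [cA infA]].
    split; first by apply: bigcup_countable => // k _; case: (AG k).
    have [_ infA0] := AG 0%N; apply: contra_not infA0; apply: sub_finite_set.
    exact: bigcup_sup.
  split=> [s t st|x]; last exact: fiber_min.
  have ts : agree phi A t s by move=> j Aj; rewrite st.
  by have [/fiber_le_off|/fiber_le_off] := off_le_total A s t; [left|right]; auto.
Qed.

End ball.

(** * Spaces of monotone functions on an uncountable well-order *)

(** The model: a compact space of nondecreasing nonnegative functions on a
well-order [W] of type omega1 + 1, with value 1 at the top. *)
Section monotone_functions.
Variables (R : realType) (K : topologicalType) (disp : Order.disp_t).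
Variables (W : orderType disp) (top : W) (phi : W -> K -> R).
Hypothesis W_top : forall x : W, (x <= top)%O.
Hypothesis W_wf : forall A : set W, A !=set0 ->
  exists2 z, A z & forall x, A x -> (z <= x)%O.
Hypothesis W_countable : forall x : W, (x < top)%O -> countable [set y | (y < x)%O].
Hypothesis W_uncountable : ~ countable [set y | (y < top)%O].
Hypothesis K_compact : compact [set: K].
Hypothesis phi_cont : forall j, continuous (phi j).
Hypothesis phi_sep : forall x y, (forall j, phi j x = phi j y) -> x = y.
Hypothesis phi_ge0 : forall j x, 0 <= phi j x.
Hypothesis phi_mono : forall x (i j : W), (i <= j)%O -> phi i x <= phi j x.
Hypothesis phi_top : forall x, phi top x = 1.
Hypothesis phi_onto : forall a : W -> R, (forall j, 0 <= a j) ->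
  (forall i j : W, (i <= j)%O -> a i <= a j) -> a top = 1 ->
  exists x, forall j, phi j x = a j.

(** Otherwise the countable segments ending at elements of [A] would cover
everything below the top. *)
Let bounded A : countable A -> (forall a, A a -> (a < top)%O) ->
  exists2 b, (b < top)%O & forall a, A a -> (a < b)%O.
Proof.
move=> cA At; apply: contrapT => nb; apply: W_uncountable.
have : countable (\bigcup_(a in A) ([set y | (y < a)%O] `|` [set a])).
  apply: bigcup_countable => // a /At /W_countable ca.
  rewrite -bigcup2E; apply: bigcup_countable => // -[//|[|k]] _ /=.
    exact: countable1.
  exact: countable0.
apply: sub_countable; apply: subset_card_le => b /= bt.
apply: contrapT => nab; apply: nb; exists b => // a Aa.
rewrite ltNge le_eqVlt; apply/negP => /orP[/eqP ba|ba]; apply: nab; exists a => //.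
  by right.
by left.
Qed.

Let limit (b : nat -> W) : (forall k, (b k < top)%O) ->
  exists al, [/\ (al < top)%O, forall k, (b k <= al)%O &
    forall x, (x < al)%O -> exists k, (x < b k)%O].
Proof.
move=> bt.
have [||c ct bc] := @bounded (range b).
- by apply: sub_countable (card_image_le _ _) _; exact: countableP.
- by move=> _ [k _ <-].
have [|al bal alm] := @W_wf [set x | forall k, (b k <= x)%O].
  by exists c => k; apply/ltW/bc; exists k.
exists al; split=> //.
  by apply: le_lt_trans ct; apply: alm => k; apply/ltW/bc; exists k.
move=> x xal; apply: contrapT => nk; move: xal; rewrite ltNge => /negP; apply.
by apply: alm => k; rewrite leNgt; apply/negP => xk; apply: nk; exists k.
Qed.

(** The top index is added to the segment so that these sets are cofinal; all
functions agree there. *)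
Let limit_segment (A : set W) := exists al, [/\ (al < top)%O,
  exists x, (x < al)%O, forall x, (x < al)%O -> exists2 y, (x < y)%O & (y < al)%O &
  A = [set x | (x < al)%O \/ x = top]].

Let limit_segment_countable A : limit_segment A -> countable A.
Proof.
move=> [al [alt _ _ ->]].
have : countable ([set x | (x < al)%O] `|` [set top]); last by [].
rewrite -bigcup2E; apply: bigcup_countable => // -[|[|k]] _ /=.
- exact: W_countable.
- exact: countable1.
- exact: countable0.
Qed.

(** [al] is the limit of a strictly increasing sequence that starts above [A]. *)
Let limit_segment_cofinal A : countable A -> exists2 B, limit_segment B & A `<=` B.
Proof.
move=> cA.
have [||b0 b0t Ab0] := @bounded (A `&` [set x | (x < top)%O]).
- by apply: sub_countable cA; apply: subset_card_le => x [].
- by move=> x [].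
have /choice[s sP] (x : W) : exists y, (x < top)%O -> (x < y < top)%O.
  have [xt|] := pselect (x < top)%O; last by exists x.
  have [||y yt xy] := @bounded [set x]; first exact: countable1.
    by move=> _ ->.
  by exists y; rewrite yt xy.
pose b k := iter k s b0.
have bt k : (b k < top)%O.
  by elim: k => //= k /sP/andP[].
have bS k : (b k < b k.+1)%O by have /sP/andP[] := bt k.
have [al [alt bal alP]] := limit bt.
exists [set x | (x < al)%O \/ x = top].
  exists al; split=> //; first by exists (b 0%N); apply: lt_le_trans (bal 1%N).
  move=> x /alP[k xk]; exists (b k) => //; exact: lt_le_trans (bal k.+1).
move=> x Ax; have := W_top x; rewrite le_eqVlt => /orP[/eqP|] xt; first by right.
by left; apply: lt_le_trans (bal 0%N); exact: Ab0.
Qed.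

Let limit_segment_bigcup (A : nat -> set W) :
  (forall k, limit_segment (A k)) -> limit_segment (\bigcup_k A k).
Proof.
move=> /choice[b bP].
have bt k : (b k < top)%O by have [] := bP k.
have [al [alt bal alP]] := limit bt.
exists al; split => //.
- by have [_ [x xb] _ _] := bP 0%N; exists x; exact: lt_le_trans (bal 0%N).
- move=> x /alP[k xk]; have [_ _ /(_ _ xk)[y xy yb] _] := bP k.
  by exists y => //; exact: lt_le_trans (bal k).
- apply/seteqP; split=> [x [k _]|x].
    have [_ _ _ ->] := bP k; case=> [xb|->]; last by right.
    by left; exact: lt_le_trans (bal k).
  case=> [/alP[k xk]|->].
    by exists k => //; have [_ _ _ ->] := bP k; left.
  by exists 0%N => //; have [_ _ _ ->] := bP 0%N; right.
Qed.

Section segment.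
Variables (al : W).
Hypothesis al_top : (al < top)%O.
Hypothesis al_ex : exists x, (x < al)%O.
Hypothesis al_limit : forall x, (x < al)%O -> exists2 y, (x < y)%O & (y < al)%O.
Let A := [set x | (x < al)%O \/ x = top].

(** Given [t'] close to [t], keep its values below [al] and from [al] on take
the maximum of [s] and [phi al t']; as [phi al t <= phi al s], this is close to
[s]. *)
Let fiber_le_segment s t : agree phi A s t -> phi al t <= phi al s ->
  fiber_le (agree phi A) s t.
Proof.
move=> st lest; apply: (fiber_le_close phi_cont phi_sep K_compact) => F e e0.
apply: filterS (close_on_nbhs phi_cont (al |` F)%fset t e0) => t' tt'.
pose a j := if (j < al)%O then phi j t' else Num.max (phi j s) (phi al t').
have [|||s' s'E] := phi_onto (a := a).
- by move=> j; rewrite /a; case: ifP => // _; rewrite le_max phi_ge0.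
- move=> i j ij; rewrite /a; case: ltP => ial; case: ltP => jal.
  + exact: phi_mono.
  + by rewrite le_max phi_mono ?orbT// ltW.
  + by move: (lt_le_trans jal (le_trans ial ij)); rewrite ltxx.
  + by rewrite ge_max !le_max phi_mono//= lexx orbT.
- rewrite /a ltNge W_top/= phi_top; apply/max_idPl.
  by rewrite -(phi_top t') phi_mono.
exists s' => [j jF|j [jal|->]]; last 2 first.
- by rewrite s'E /a jal.
- by rewrite !phi_top.
rewrite s'E /a; case: (ltP j al) => jal.
  by rewrite st; [apply: tt'; rewrite !inE jF orbT|left].
rewrite distrC ger0_norm ?subr_ge0 ?le_max ?lexx// ltrBlDl gt_max ltrDl e0/=.
have /tt' : al \in (al |` F)%fset by rewrite !inE eqxx.
rewrite ltr_distlC => /andP[_ /lt_le_trans]; apply.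
by rewrite lerD2r (le_trans lest)// phi_mono.
Qed.

(** The least point jumps to 1 at [al]. Since [al] is a limit, functions that
jump to 1 slightly earlier are close to it, and by monotonicity everything in
the fiber of such a function has value 1 at [al]. *)
Let fiber_min_segment x : exists2 e, agree phi A x e &
  forall t, agree phi A x t -> fiber_le (agree phi A) t e -> t = e.
Proof.
have phi_le1 j y : phi j y <= 1 by rewrite -(phi_top y) phi_mono.
have jump b : exists y, forall j, phi j y = if (j < b)%O then phi j x else 1.
  apply: phi_onto => [j|i j ij|]; first by case: ifP.
    case: ltP => ib; case: ltP => jb //; first exact: phi_mono.
    by move: (lt_le_trans jb (le_trans ib ij)); rewrite ltxx.
  by rewrite ltNge W_top.
have [e eE] := jump al.
exists e => [j [jal|->]|t xt te]; [by rewrite eE jal|by rewrite !phi_top|].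
apply: contrapT => ne.
have [j tj] : exists j, phi j t <> phi j e.
  by apply: contrapT => n; apply: ne; apply: phi_sep => j; apply: contrapT => ?;
    apply: n; exists j.
have tal1 : phi al t < 1.
  have alj : (al <= j)%O.
    by rewrite leNgt; apply/negP => jal; apply: tj; rewrite eE jal xt//; left.
  rewrite (le_lt_trans (phi_mono t alj))// lt_neqAle phi_le1 andbT.
  by apply/eqP; move: tj; rewrite eE ltNge alj.
have /te/(nbhs_close_on phi_cont phi_sep K_compact)[F [d d0 FU]] :
    nbhs t (phi al @^-1` [set c | c < 1]).
  by apply: phi_cont; apply: open_nbhs_nbhs; split => //; exact: open_lt.
have [c cal Fc] : exists2 c, (c < al)%O &
    forall j, j \in F -> (j < al)%O -> (j < c)%O.
  have : forall l : seq W, exists2 c, (c < al)%O &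
      forall j, j \in l -> (j < al)%O -> (j < c)%O.
    elim=> [|i l [c cal lc]]; first by have [c ?] := al_ex; exists c.
    have [ial|ali] := ltP i al; last first.
      exists c => // k; rewrite inE => /orP[/eqP -> ial|]; last exact: lc.
      by move: (lt_le_trans ial ali); rewrite ltxx.
    have /al_limit[c' mc' c'al] : (Order.max i c < al)%O by rewrite gt_max ial.
    exists c' => // k; rewrite inE => /orP[/eqP ->|kl kal].
      by rewrite (le_lt_trans _ mc')// le_max lexx.
    by rewrite (lt_trans (lc k kl kal))// (le_lt_trans _ mc')// le_max lexx orbT.
  by move=> /(_ (enum_fset F)).
have [y yE] := jump c.
have [|u /= ual uy] := FU y.
  move=> i iF; rewrite yE eE; have [/Fc -> //|ali] := ltP i al.
    by rewrite subrr normr0.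
  by rewrite ltNge (le_trans (ltW cal) ali)/= subrr normr0.
move: ual; rewrite ltNge => /negP; apply.
rewrite (le_trans _ (phi_mono u (ltW cal)))// uy; last by left.
by rewrite yE ltxx.
Qed.

Lemma segment_linear_fibers : linear_fibers (agree phi A).
Proof.
split=> [s t st|x]; last exact: fiber_min_segment.
have ts : agree phi A t s by move=> j Aj; rewrite st.
by have [ts'|st'] := leP (phi al t) (phi al s); [left|right];
  apply: fiber_le_segment => //; exact: ltW.
Qed.

End segment.

Lemma monotone_linear_quotients : linear_quotients R K.
Proof.
exists W, phi, limit_segment; split => //.
split=> // A [al [alt ale all ->]]; exact: segment_linear_fibers.
Qed.

End monotone_functions.

(** * The Hilbert ball in its weak topology *)

Lemma family_continuous (R : realType) (J : Type) (S : choiceType)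
    (phi : J -> S -> R) (j : J) :
  continuous (phi j : family_topology phi -> R).
Proof.
move=> x.
have /cvg_sup/(_ j) xj : nbhs (x : family_topology phi) --> (x : family_topology phi).
  exact: cvg_id.
move=> U /(@initial_continuous _ _ (phi j)) Ux.
exact: xj.
Qed.

Section hilbert_ball.
Variables (R : realType) (kappa : choiceType).
Local Notation ell2 := (ell2 R kappa).
Local Notation ball := (weak_unit_ball R kappa).

Definition coordinate (i : kappa) (x : ell2) : R^o := x i.

Lemma coordinate_is_linear i : linear (coordinate i).
Proof. by []. Qed.

HB.instance Definition _ i :=
  GRing.isLinear.Build R ell2 R^o _ (coordinate i) (coordinate_is_linear i).

Lemma sum_sqr_le_norm (x : ell2) (F : {fset kappa}) :
  \sum_(i <- F) x i ^+ 2 <= `|x| ^+ 2.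
Proof.
rewrite -lee_fin -[ `|x| ]/(ell2_norm x) -sqsum_fin.
apply: ereal_sup_ubound; exists [set` F]; first by split.
by rewrite fsbig_finite// set_fsetK sumEFin.
Qed.

Lemma coordinate_le i (x : ell2) : `|x i| <= `|x|.
Proof.
have := sum_sqr_le_norm x [fset i]%fset; rewrite big_seq_fset1.
by rewrite -[_ ^+ 2]real_normK ?num_real// ler_pXn2r// nnegrE.
Qed.

Lemma coordinate_continuous i : continuous (coordinate i).
Proof.
move=> x U /nbhs_ballP[e /= e0 eU].
have : nbhs x (ball_ Num.norm x e) by rewrite ball_normE; exact: nbhsx_ballx.
apply: filterS => y /= xye; apply: eU; rewrite -ball_normE /=.
have -> : coordinate i x - coordinate i y = coordinate i (x - y) by [].
exact: le_lt_trans (coordinate_le i (x - y)) xye.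
Qed.

Definition ball_coordinate (i : kappa) (x : ball) : R := (set_val x : ell2) i.

Lemma ball_coordinate_continuous i : continuous (ball_coordinate i).
Proof.
move=> x.
pose f : {f : {linear ell2 -> R^o} | continuous f} :=
  exist _ (coordinate i : {linear ell2 -> R^o}) (@coordinate_continuous i).
apply: (@continuous_comp ball (weak_topology ell2) R set_val (sval f)).
  exact: initial_continuous.
exact: (@family_continuous R _ _ _ f).
Qed.

Lemma ell2_of_sums (a : kappa -> R) :
  (forall F : {fset kappa}, \sum_(i <- F) a i ^+ 2 <= 1) ->
  exists2 x : ell2, `|x| <= 1 & ell2_fun x = a.
Proof.
move=> a1.
have sa : (sqsum a <= 1)%E.
  apply: ge_ereal_sup => _ [F [finF _] <-].
  by rewrite fsbig_finite// sumEFin lee_fin.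
have aP : a \in @square_summable R kappa.
  by rewrite inE /=; apply: le_lt_trans sa (ltry _).
exists (Ell2 aP) => //.
have : (sqsum (Ell2 aP) <= 1)%E by [].
rewrite sqsum_fin lee_fin -[X in _ -> X <= _]/(ell2_norm _).
by rewrite -[X in _ <= X -> _](expr1n R 2) ler_pXn2r// nnegrE// ell2_norm_ge0.
Qed.

Lemma hilbert_ball_linear_quotients :
  ~ countable [set: kappa] -> compact [set: ball] -> linear_quotients R ball.
Proof.
move=> nc cK; apply: (@ball_linear_quotients R ball kappa ball_coordinate setT) => //.
- exact: ball_coordinate_continuous.
- move=> x y xy; apply: val_inj; apply: (@val_inj _ _ ell2).
  by apply/funext => i; exact: xy.
- move=> x F; apply: (le_trans (sum_sqr_le_norm _ F)).
  have /set_mem /= x1 := valP x.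
  by rewrite exprn_ile1.
- move=> a _ /ell2_of_sums[x x1 xa].
  exists (SigSub (mem_set (x1 : [set x : ell2 | `|x| <= 1] x)) : ball) => i.
  by rewrite /ball_coordinate /= xa.
Qed.

End hilbert_ball.

(** * Radon probabilities determined by clopen sets *)

Lemma eq_probability d (T : measurableType d) (R : realType)
    (P Q : probability T R) : (P = Q :> (set T -> \bar R)) -> P = Q.
Proof.
case: P Q => [P [[p0 p1] [p2] [p3] [p4] [p5] [p6] [p7]]].
case=> [Q [[+ +] [+] [+] [+] [+] [+] [+]]] /= PQ.
rewrite -{Q}PQ => q0 q1 q2 q3 q4 q5 q6 q7; f_equal.
by rewrite (_ : q0 = p0)// (_ : q1 = p1)// (_ : q2 = p2)// (_ : q3 = p3)//
  (_ : q4 = p4)// (_ : q5 = p5)// (_ : q6 = p6)// (_ : q7 = p7).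
Qed.

Section radon_measures.
Variables (R : realType) (X : ptopologicalType).
Local Notation PX := (prob_space R X).
Implicit Types mu nu : PX.

Definition mass mu (A : set X) : R := fine ((set_val mu : probability _ _) A).

Lemma open_borel (A : set X) : open A -> @measurable _ (borel X) A.
Proof. by move=> oA; exact: sub_sigma_algebra. Qed.

Lemma massE mu (A : set X) : @measurable _ (borel X) A ->
  (set_val mu : probability _ _) A = (mass mu A)%:E.
Proof. by move=> mA; rewrite fineK//; exact: fin_num_measure. Qed.

Lemma mass_ge0 mu (A : set X) : 0 <= mass mu A.
Proof. by apply: fine_ge0; exact: measure_ge0. Qed.

Lemma massT mu : mass mu setT = 1.
Proof. by rewrite /mass probability_setT. Qed.

Lemma mass_le mu (A B : set X) : @measurable _ (borel X) A ->
  @measurable _ (borel X) B -> A `<=` B -> mass mu A <= mass mu B.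
Proof.
by move=> mA mB AB; rewrite -lee_fin -!massE//; apply: le_measure; rewrite ?inE.
Qed.

(** The mass of a clopen set is the integral of its continuous indicator. *)
Lemma mass_continuous (A : set X) : clopen A -> continuous (mass^~ A : PX -> R).
Proof.
move=> [oA cA].
have mA := open_borel oA.
have cI : continuous (\1_A : X -> R).
  move=> x U Ux; rewrite /= indicE in Ux; rewrite nbhs_simpl/=.
  have [xA|xA] := boolP (x \in A).
    have : nbhs x A by apply: open_nbhs_nbhs; split => //; exact: set_mem.
    apply: filterS => y yA; rewrite /= indicE mem_set//.
    by rewrite xA in Ux; exact: nbhs_singleton.
  have : nbhs x (~` A).
    apply: open_nbhs_nbhs; split; first exact: closed_openC.
    by move=> Ax; rewrite mem_set in xA.
  apply: filterS => y yA; rewrite /= indicE memNset//.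
  by rewrite (negbTE xA) in Ux; exact: nbhs_singleton.
pose f : {f : X -> R | continuous f} := exist _ (\1_A : X -> R) cI.
have -> : (mass^~ A : PX -> R) = (fun mu => \int[set_val mu]_x (sval f x : R)).
  apply/funext => mu; rewrite /mass /Rintegral /=.
  by rewrite integral_indic// setIT.
exact: (@family_continuous R _ _ _ f).
Qed.

Lemma radon_inner mu (A : set X) : @measurable _ (borel X) A ->
  (set_val mu : probability _ _) A = ereal_sup [set (set_val mu : probability _ _) Q |
    Q in [set Q : set X | compact Q /\ Q `<=` A]].
Proof. by have /set_mem[+ _] := valP mu; apply. Qed.

(** The two measures agree on the sigma-algebra generated by [C], and between
a compact set and an open set containing it there is a set of that
sigma-algebra. Inner regularity, applied to complements of compact sets and
then to arbitrary Borel sets, does the rest. *)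
Lemma radon_ext (C : set (set X)) mu nu :
  hausdorff_space X -> setI_closed C -> C setT -> (forall A, C A -> clopen A) ->
  (forall (x : X) U, nbhs x U -> exists D, [/\ <<s C>> D, nbhs x D & D `<=` U]) ->
  (forall A, C A -> mass mu A = mass nu A) -> mu = nu.
Proof.
move=> hX CI CT Cc Cb CE.
have Cm A : C A -> @measurable _ (borel X) A by move=> /Cc[oA _]; exact: open_borel.
have sCm A : <<s C>> A -> @measurable _ (borel X) A.
  by apply: smallest_sub => //; exact: sigma_algebra_measurable.
have sCE A : <<s C>> A -> mass mu A = mass nu A.
  move=> sA; congr fine.
  apply: (@g_sigma_algebra_measure_unique _ R (borel X) C Cm (fun=> setT)) => //.
  - by rewrite bigcup_const.
  - move=> B CB; have mB := Cm _ CB; transitivity (mass mu B)%:E; first exact: massE.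
    by rewrite CE//; apply/esym; exact: massE.
  - move=> _; rewrite (_ : _ setT = (mass mu setT)%:E) ?ltry//.
    by apply: massE; exact: Cm.
have sep (Q O : set X) : compact Q -> open O -> Q `<=` O ->
    exists D, [/\ <<s C>> D, Q `<=` D & D `<=` O].
  rewrite compact_cover => cQ oO QO.
  have [||F FD QF] := cQ (set X) [set D | <<s C>> D /\ D `<=` O] interior.
  - by move=> D _; exact: open_interior.
  - move=> x /QO Ox; have [D [sD xD DO]] := Cb x O (open_nbhs_nbhs (conj oO Ox)).
    by exists D.
  exists (\bigcup_(D in [set` F]) D); split.
  - apply: (@fin_bigcup_measurable _ (g_sigma_algebraType C)) => // D /= /FD.
    by rewrite inE => -[].
  - by move=> x /QF[D DF] /interior_subset; exists D.
  - by move=> x [D /= /FD]; rewrite inE => -[_]; exact.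
have cm (Q : set X) : compact Q -> @measurable _ (borel X) Q.
  move=> /(compact_closed hX)/closed_openC/open_borel.
  by rewrite -[X in _ -> _ X]setCK; exact: measurableC.
have le_compact mu' nu' (Q : set X) :
    (forall A, <<s C>> A -> mass mu' A = mass nu' A) -> compact Q ->
    mass mu' Q <= mass nu' Q.
  move=> E cQ; have mQ := cm _ cQ.
  have : ((set_val nu' : probability _ _) (~` Q) <= (1 - mass mu' Q)%:E)%E.
    rewrite radon_inner; last exact: measurableC.
    apply: ge_ereal_sup => _ [Q' [cQ' Q'Q] <-]; have mQ' := cm _ cQ'.
    have [|x Qx Q'x|D [sD QD DQ']] := sep Q (~` Q') cQ.
    - by apply: closed_openC; apply: compact_closed.
    - exact: Q'Q Q'x Qx.
    rewrite massE// lee_fin lerBrDr -(massT nu').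
    apply: (@le_trans _ _ (mass nu' Q' + mass nu' D)).
      by rewrite lerD2l -E//; apply: mass_le => //; exact: sCm.
    have mD := sCm _ sD.
    rewrite -lee_fin EFinD -!massE//.
    rewrite -measureU//; first by apply: le_measure; rewrite ?inE//; exact: measurableU.
    by apply/disjoints_subset => x Q'x /DQ'; exact.
  rewrite probability_setC// massE// -EFinB lee_fin.
  by rewrite lerD2l lerN2.
apply: val_inj; apply: eq_probability; apply/funext => A.
have [mA|nA] := pselect (@measurable _ (borel X) A); last first.
  have /set_mem[_ h1] := valP mu; have /set_mem[_ h2] := valP nu.
  by rewrite [LHS]h1// [RHS]h2.
rewrite [LHS]radon_inner// [RHS]radon_inner//; congr ereal_sup.
apply: eq_imagel => Q [cQ _]; rewrite !massE; [|exact: cm..].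
by congr EFin; apply/le_anti/andP; split; apply: le_compact => // B /sCE.
Qed.

(** The sum of weighted Dirac measures, set to 0 outside the Borel sets; it is
inner regular because the atoms in a set form a compact subset of full mass. *)
Lemma atomic_exists (w : seq (R * X)) : hausdorff_space X ->
  (forall q, q \in w -> 0 <= q.1) -> \sum_(q <- w) q.1 = 1 ->
  exists mu, forall A, @measurable _ (borel X) A ->
    mass mu A = \sum_(q <- w) q.1 * (q.2 \in A)%:R.
Proof.
move=> hX w0 w1.
have c0 k : 0 <= (nth (0, point) w k).1.
  have [kw|kw] := ltnP k (size w); last by rewrite nth_default.
  exact/w0/mem_nth.
pose m k : {measure set (borel X) -> \bar R} :=
  mscale (NngNum (c0 k)) (dirac ((nth (0, point) w k).2 : borel X)).
pose M : {measure set (borel X) -> \bar R} := msum m (size w).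
have ME A : M A = (\sum_(q <- w) q.1 * (q.2 \in A)%:R)%:E.
  rewrite /M /= /msum (big_nth (0, point)) big_mkord -sumEFin; apply: eq_bigr => k _.
  by rewrite /m /= /mscale /= diracE.
pose P (A : set (borel X)) : \bar R := if pselect (measurable A) then M A else 0%E.
have PM A : measurable A -> P A = M A by rewrite /P; case: pselect.
have P0 : P set0 = 0%E by rewrite PM// measure0.
have Pge0 A : (0 <= P A)%E by rewrite /P; case: pselect => // _; exact: measure_ge0.
have Psa : semi_sigma_additive P.
  move=> F mF tF mUF; rewrite PM//.
  under eq_fun do under eq_bigr do rewrite PM//.
  exact: measure_semi_sigma_additive.
have P1 : P setT = 1%E.
  rewrite PM// ME -[in RHS]w1; congr EFin; apply: eq_bigr => q _.
  by rewrite in_setT mulr1.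
pose mP : {measure set (borel X) -> \bar R} :=
  HB.pack P (isMeasure.Build _ _ _ P P0 Pge0 Psa).
pose PP : probability (borel X) R :=
  HB.pack_for (probability (borel X) R) P (isMeasure.Build _ _ _ P P0 Pge0 Psa)
    (Measure_isProbability.Build _ _ _ mP P1).
have PPr : radon PP.
  split=> A mA; last by rewrite /= /P; case: pselect.
  apply/eqP; rewrite eq_le; apply/andP; split; last first.
    apply: ge_ereal_sup => _ [Q [_ QA] <-].
    have [mQ|nQ] := pselect (@measurable _ (borel X) Q).
      by apply: le_measure; rewrite ?inE.
    by rewrite [leLHS](_ : _ = 0%E)// /= /P; case: pselect.
  apply: ereal_sup_ubound; exists (A `&` [set q.2 | q in [set` w]]).
    split; last by move=> x [].
    by apply: finite_compact; apply: finite_setIr; exact: finite_image.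
  have mQ : @measurable _ (borel X) (A `&` [set q.2 | q in [set` w]]).
    rewrite -[X in measurable X]setCK; apply: measurableC; apply: open_borel.
    apply: closed_openC; apply: compact_closed => //.
    by apply: finite_compact; apply: finite_setIr; exact: finite_image.
  rewrite /= !PM// !ME; congr EFin; apply: eq_big_seq => q qw.
  congr (_ * (nat_of_bool _)%:R); apply/idP/idP; rewrite !inE; first by case.
  by split=> //; exists q.
exists (SigSub (mem_set PPr) : PX) => A mA.
by rewrite /mass /= PM// ME.
Qed.

End radon_measures.

(** The values prescribed on finite sets of indices define closed sets with
the finite intersection property. This produces probabilities with infinitely
many atoms from finite sums of Dirac measures. *)
Lemma compact_interpolation (R : realType) (K : topologicalType) (J : choiceType)
    (phi : J -> K -> R) (a : J -> R) :
  compact [set: K] -> (forall j, continuous (phi j)) ->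
  (forall F : {fset J}, exists x, forall j, j \in F -> phi j x = a j) ->
  exists x, forall j, phi j x = a j.
Proof.
move=> cK cphi aF; apply: contrapT => na.
have [|||F F0] := @compact_bigcap_sub K J (fun j => phi j @^-1` [set a j]) set0 cK.
- by move=> j; apply: preimage_closed => [x _|]; [exact: cphi|exact: closed_eq].
- exact: open0.
- by move=> x xa; apply: na; exists x => j; exact: xa.
by have [x xF] := aF F; apply: (F0 x) => j jF; exact: xF.
Qed.

(** * Probabilities on a one-point compactification *)

Section one_point.
Variables (R : realType) (kappa : choiceType).
Local Notation A := (one_point_discrete kappa).

Lemma point_clopen (j : kappa) : clopen ([set Some j] : set A).
Proof.
have oj (i : kappa) : @open A [set Some i].
  have -> : [set Some i] = (Some : discrete_topology kappa -> A) @` [set i].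
    by rewrite image_set1.
  by apply: one_point_compactification_open_some; exact: discrete_open.
split; first exact: oj.
rewrite -[X in closed X]setCK; apply: open_closedC.
rewrite openE => -[i|] ij; rewrite /interior.
  apply: (@filterS _ (nbhs (Some i : A)) _ [set Some i]); first by move=> _ ->.
  exact: (open_nbhs_nbhs (conj (oj i) erefl)).
exists ([set j] : set (discrete_topology kappa)).
  by split; [exact: compact_set1|exact: discrete_closed].
by move=> _ [[i ij' <-]|->] // [] /ij'.
Qed.

(** Compactness is transported to the compactification, where the points of
[kappa] are still open. *)
Lemma discrete_compact_finite (W : set (discrete_topology kappa)) :
  compact W -> finite_set W.
Proof.
move=> cW.
have : compact ((Some : discrete_topology kappa -> A) @` W).
  apply: continuous_compact => //.
  exact/continuous_subspaceT/one_point_compactification_some_continuous.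
rewrite compact_cover => /(_ kappa setT (fun j => [set Some j]))[|_ [j _ <-]|F _ WF].
- by move=> j _; case: (point_clopen j).
- by exists j.
apply: sub_finite_set (finite_fset F) => j Wj.
by have [|i iF [->]] := WF (Some j); first by exists j.
Qed.

Lemma one_point_hausdorff : hausdorff_space A.
Proof.
have sep (j : kappa) (x : A) : x != Some j -> exists2 AB : set A * set A,
    x \in AB.1 /\ Some j \in AB.2 & [/\ open AB.1, open AB.2 & AB.1 `&` AB.2 == set0].
  move=> xj; have [oj cj] := point_clopen j.
  exists (~` [set Some j], [set Some j]); rewrite /= ?inE; first by split=> //; exact/eqP.
  by split=> //; [exact: closed_openC|rewrite setICl].
rewrite open_hausdorff => x y; case: y => [j /sep//|]; case: x => [j|//].
rewrite eq_sym => /sep[[B C] /= [xB yC] [oB oC BC]].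
by exists (C, B); split => //; rewrite setIC.
Qed.

Lemma one_point_prob_ext (mu nu : prob_space R A) :
  (forall j, mass mu [set Some j] = mass nu [set Some j]) -> mu = nu.
Proof.
move=> E.
pose C : set (set A) := [set B | B = set0 \/ B = setT \/ exists j, B = [set Some j]].
have Cj j : C [set Some j] by right; right; exists j.
apply: (@radon_ext R A C) => //.
- exact: one_point_hausdorff.
- move=> B1 B2 [->|[->|[j ->]]]; first by rewrite set0I => _; left.
    by rewrite setTI.
  move=> [->|[->|[i ->]]]; first by rewrite setI0; left.
    by rewrite setIT.
  have [<-|ij] := eqVneq i j; first by rewrite setIid.
  left; apply/seteqP; split=> // x [/= -> [] ji].
  by rewrite ji eqxx in ij.
- by right; left.
- move=> B [->|[->|[j ->]]]; last exact: point_clopen.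
    by split; [exact: open0|exact: closed0].
  by split; [exact: openT|exact: closedT].
- move=> [j|] U xU.
    exists [set Some j]; split; first exact: sub_sigma_algebra.
      by apply: open_nbhs_nbhs; split => //; case: (point_clopen j).
    by move=> _ ->; exact: (@nbhs_singleton A (Some j) U xU).
  have [W [cW _] WU] := xU.
  have finW := discrete_compact_finite cW.
  exists (~` (\bigcup_(j in W) [set Some j])); split.
  + apply: (@measurableC _ (g_sigma_algebraType C)).
    apply: (@fin_bigcup_measurable _ (g_sigma_algebraType C)) => // j _.
    exact: sub_sigma_algebra.
  + apply: (@open_nbhs_nbhs A None); split; last by move=> [].
    by apply: closed_openC; apply: closed_bigcup => // j _; case: (point_clopen j).
  + move=> [j|] nj; apply: WU; [left; exists j => // Wj|by right].
    by apply: nj; exists j.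
- by move=> B [->|[->|[j ->]]//]; rewrite ?massT// /mass !measure0.
Qed.

(** The coordinates are the square roots of the weights of the points of
[kappa]; the point at infinity carries the remaining mass. *)
Lemma one_point_linear_quotients : ~ countable [set: kappa] ->
  compact [set: prob_space R A] -> linear_quotients R (prob_space R A).
Proof.
move=> nc cK.
have hA := one_point_hausdorff.
have mj (j : kappa) : @measurable _ (borel A) [set Some j].
  by apply: open_borel; case: (point_clopen j).
pose phi (j : kappa) (mu : prob_space R A) := Num.sqrt (mass mu [set Some j]).
have phi2 j mu : phi j mu ^+ 2 = mass mu [set Some j] by rewrite sqr_sqrtr// mass_ge0.
have cphi j : continuous (phi j).
  move=> mu; have cm : {for mu, continuous (fun nu : prob_space R A => mass nu [set Some j])}.
    by apply: mass_continuous; exact: point_clopen.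
  exact: (continuous_comp cm (@sqrt_continuous R _)).
apply: (@ball_linear_quotients R _ kappa phi [set c | 0 <= c]) => //=.
- move=> mu nu E; apply: one_point_prob_ext => j.
  by rewrite -!phi2 E.
- by move=> r c /andP[r0 _]; exact: mulr_ge0.
- by move=> j mu; exact: sqrtr_ge0.
- move=> mu F; rewrite (eq_bigr (fun j => mass mu [set Some j])) => [|j _]; last exact: phi2.
  pose P : {measure set (borel A) -> \bar R} := (set_val mu : probability _ _).
  pose S (j : kappa) : set (borel A) := [set Some j].
  have PF : P (\big[setU/set0]_(j <- F) S j) = (\sum_(j <- F) P (S j))%E.
    by apply: measure_fbigsetU => [j _|i j _ _ [x [-> [ij]]]//]; exact: mj.
  have -> : \sum_(j <- F) mass mu (S j) = fine (P (\big[setU/set0]_(j <- F) S j)).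
    rewrite PF (eq_bigr (fun j => (mass mu (S j))%:E)) => [|j _].
      by rewrite sumEFin.
    by apply: massE; exact: mj.
  rewrite -(@fine1 R); apply: fine_le => //.
    by apply: fin_num_measure; apply: bigsetU_measurable => j _; exact: mj.
  by apply: probability_le1; apply: bigsetU_measurable => j _; exact: mj.
move=> a a0 a1; apply: compact_interpolation => // F.
pose w := (1 - \sum_(j <- F) a j ^+ 2, None) :: [seq (a j ^+ 2, Some j) | j <- F].
have [||mu muE] := @atomic_exists R A w hA.
- move=> q; rewrite inE => /orP[/eqP ->|/mapP[j _ ->]] /=; last exact: sqr_ge0.
  by rewrite subr_ge0.
- by rewrite big_cons big_map /= subrK.
exists mu => j jF; rewrite /phi muE// big_cons big_map /= memNset// mulr0 add0r.
rewrite (bigD1_seq j) ?fset_uniq//= mem_set// mulr1 big1 ?addr0 ?sqrtr_sqr ?ger0_norm//.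
move=> i ij; rewrite memNset ?mulr0// => -[] ji.
by rewrite ji eqxx in ij.
Qed.

End one_point.

(** * Probabilities on the ordinals up to omega1 *)

Section omega1_probabilities.
Variable R : realType.
Local Notation W := omega1_space.
Local Notation top := (None : omega1_closed).
Implicit Types i j x y : omega1_closed.

Definition initial_segment j : set W := [set y : omega1_closed | (y <= j)%O].

Lemma initial_segmentT : initial_segment top = setT.
Proof. by apply/seteqP; split=> // x _; exact: omega1_le_top. Qed.

(** Either [j] is the last element or [y <= j] means that [y] lies strictly
below the successor of [j]. *)
Lemma initial_segment_clopen j : clopen (initial_segment j).
Proof.
have segE x : initial_segment x = `]-oo, (x : order_topology omega1_closed)]%classic.
  by apply/seteqP; split=> y /=; rewrite in_itv.
split; last by rewrite segE; exact: (@lray_closed _ (order_topology omega1_closed)).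
have [[a ja]|nj] := pselect (exists a : omega1_closed, (j < a)%O); last first.
  rewrite (_ : initial_segment j = setT); first exact: openT.
  apply/seteqP; split=> // y _; rewrite /initial_segment /= leNgt; apply/negP => jy.
  by apply: nj; exists y.
have [|z jz zm] := @omega1_wf [set a | (j < a)%O]; first by exists a.
rewrite (_ : initial_segment j =
    `]-oo, (z : order_topology omega1_closed)[%classic); last first.
  apply/seteqP; split=> y /=; rewrite /initial_segment /= in_itv /=.
    by move=> /le_lt_trans; apply.
  by move=> yz; rewrite leNgt; apply/negP => /zm; rewrite leNgt yz.
exact: (@lray_open _ (order_topology omega1_closed)).
Qed.

Lemma omega1_prob_ext (mu nu : prob_space R W) :
  (forall j, mass mu (initial_segment j) = mass nu (initial_segment j)) -> mu = nu.
Proof.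
move=> E; pose C : set (set W) := range initial_segment.
apply: (@radon_ext R W C).
- exact: (@order_hausdorff _ (order_topology omega1_closed)).
- move=> _ _ [i _ <-] [j _ <-]; exists (Order.min i j) => //.
  by apply/seteqP; split=> y; rewrite /initial_segment /= le_min => /andP.
- by exists top => //; exact: initial_segmentT.
- by move=> _ [j _ <-]; exact: initial_segment_clopen.
- move=> x U.
  have -> : nbhs (x : W) U = nbhs (x : order_topology omega1_closed) U by [].
  rewrite {1}itv_nbhsE => -[[lo hi] [ends xi] iU].
  have sC j : <<s C>> (initial_segment j) by apply: sub_sigma_algebra; exists j.
  have hiP y : (y <= x)%O -> (BRight y <= hi)%O.
    by move=> yx; move: xi; rewrite itv_boundlr => /andP[_]; apply: le_trans; rewrite bnd_simp.
  have xU : nbhs (x : W) (initial_segment x).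
    by have [oS _] := initial_segment_clopen x; exact: (open_nbhs_nbhs (conj oS (lexx x))).
  case: lo => [b a|b] in ends xi iU *; last first.
    exists (initial_segment x); split=> [||y yx]; [exact: sC|exact: xU|].
    apply: iU => /=; case: b ends xi => // ends xi.
    by rewrite itv_boundlr /= hiP.
  case: b ends xi iU => [|] ends xi iU; first by case: (hi) ends => [[]?|[]].
  have ax : (a < x)%O by move: xi; rewrite itv_boundlr => /andP[]; rewrite bnd_simp.
  exists (initial_segment x `\` initial_segment a); split.
  + by apply: (@measurableD _ (g_sigma_algebraType C)); exact: sC.
  + apply: filterI; first exact: xU.
    have [_ cS] := initial_segment_clopen a.
    apply: (open_nbhs_nbhs (conj (closed_openC cS) _)).
    by rewrite /initial_segment /= leNgt ax.
  + move=> y [yx /negP]; rewrite -ltNge => ay; apply: iU.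
    by rewrite /= itv_boundlr hiP// andbT bnd_simp.
- by move=> _ [j _ <-].
Qed.

(** Each point of the increasing list [l] receives the increment of [a] from
its predecessor; [b] is the value reached before the first point. *)
Lemma step_measure (a : omega1_closed -> R) (l : seq omega1_closed) (b : R) :
  sorted <%O l -> (forall j, j \in l -> b <= a j) ->
  (forall i j, (i <= j)%O -> a i <= a j) ->
  exists w : seq (R * W), (forall q, q \in w -> 0 <= q.1 /\ q.2 \in l) /\
    forall j, j \in l -> \sum_(q <- w) q.1 * (q.2 \in initial_segment j)%:R = a j - b.
Proof.
move=> + + amono; elim: l b => [|j l IH] b jl bl; first by exists [::].
have [||w [w0 wE]] := IH (a j); first exact: path_sorted jl.
  move=> i il; apply/amono/ltW.
  by have /allP := order_path_min lt_trans jl; apply.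
exists ((a j - b, j : W) :: w); split=> [q|i].
  rewrite !inE => /orP[/eqP ->/=|/w0[-> ->]]; last by rewrite orbT.
  by rewrite subr_ge0 bl ?eqxx// inE eqxx.
rewrite inE big_cons /= => /orP[/eqP ->|il].
  rewrite mem_set ?mulr1; last exact: lexx.
  rewrite big1_seq ?addr0// => q /= /w0[_ ql]; rewrite memNset ?mulr0//.
  have /allP/(_ _ ql) := order_path_min lt_trans jl.
  by rewrite /initial_segment /= leNgt => ->.
rewrite wE// mem_set ?mulr1; first by rewrite addrC subrKA.
have /allP/(_ _ il) := order_path_min lt_trans jl.
exact: ltW.
Qed.

(** The functions are the distribution functions of the probabilities; every
nondecreasing one is reached by interpolation from step functions. *)
Lemma omega1_linear_quotients :
  compact [set: prob_space R W] -> linear_quotients R (prob_space R W).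
Proof.
move=> cK.
have hW : hausdorff_space W by exact: (@order_hausdorff _ (order_topology omega1_closed)).
have mS j : @measurable _ (borel W) (initial_segment j).
  by apply: open_borel; case: (initial_segment_clopen j).
pose phi j (mu : prob_space R W) := mass mu (initial_segment j).
have cphi j : continuous (phi j) by apply: mass_continuous; exact: initial_segment_clopen.
apply: (@monotone_linear_quotients R _ _ omega1_closed top phi) => //.
- exact: omega1_le_top.
- exact: omega1_wf.
- exact: omega1_lt_countable.
- exact: omega1_uncountable.
- by move=> mu nu; exact: omega1_prob_ext.
- by move=> j mu; exact: mass_ge0.
- by move=> mu i j ij; apply: mass_le => // y; rewrite /initial_segment /= => /le_trans; apply.
- by move=> mu; rewrite /phi initial_segmentT massT.
move=> a a0 amono atop; apply: compact_interpolation => // F.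
pose l := sort <=%O (enum_fset (top |` F)%fset).
have ll : sorted <%O l.
  by rewrite lt_sorted_uniq_le sort_uniq fset_uniq sort_le_sorted.
have lF j : j \in (top |` F)%fset -> j \in l by rewrite mem_sort.
have [w [w0 wE]] := step_measure ll (fun j _ => a0 j) amono.
have [||mu muE] := @atomic_exists R W w hW.
- by move=> q /w0[].
- have := wE top (lF _ (fset1U1 _ _)); rewrite atop subr0 => <-.
  by apply: eq_bigr => q _; rewrite initial_segmentT in_setT mulr1.
by exists mu => j jF; rewrite /phi muE// wE ?subr0//; apply: lF; rewrite inE jF orbT.
Qed.

End omega1_probabilities.

Theorem theorem1p7 (R : realType) (kappa : choiceType)
    (kappa_uncountable : ~ countable [set: kappa])
    (K : topologicalType)
    (hK : K = weak_unit_ball R kappa \/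
          K = prob_space R (one_point_discrete kappa) \/
          K = prob_space R omega1_space)
    (n m : nat) (n_ge1 : (1 <= n)%N) (m_ge1 : (1 <= m)%N)
    (L : 'I_m -> topologicalType)
    (L_compact : forall i : 'I_m, compact_space (L i))
    (L_weight : forall i : 'I_m, uncountable_weight (L i))
    (hKL : homeomorphic (power K n) (prod_topology L)) :
  (m <= n)%N.
Proof.
have cL i : compact [set: L i] by case: (L_compact i).
have cK := homeomorphic_power_compact n_ge1 cL hKL.
apply: (@linear_quotients_factors R K n m L) => //.
case: hK => [E|[E|E]]; rewrite {}E in cK *.
- exact: hilbert_ball_linear_quotients.
- exact: one_point_linear_quotients.
- exact: omega1_linear_quotients.
Qed.
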